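(* Let $H$ be a real Hilbert space, $\mathbb B_H=\{x\in H:|x|<1\}$, let $p\in\mathbb B_H$ and let $\Lambda\subset H$ be a real two-dimensional linear subspace. Write $p=p_\Lambda+p_\perp$ with $p_\Lambda\in\Lambda$, $p_\perp\perp\Lambda$, and set $$a=|p_\Lambda|,\qquad b=|p_\perp|,\qquad c=\sqrt{1-b^2},\qquad s=\frac ac .$$ Let $T=E_s^c$ be the normalized Möbius parametrization of $(p+\Lambda)\cap\mathbb B_H$, and let $\Phi_T=T|_{\mathbb T}$. For every $F=P[\Phi_F]\in\mathcal F_{\mathbb B_H}^{\mathrm n}(p,\Lambda)$ set $$\delta=\|dT_0\|-\|dF_0\|\ge0 .$$ Then $$2c\delta=\int_{\mathbb T}w_s|\Phi_F-\Phi_T|^2\,dm+\int_{\mathbb T}w_s(1-|\Phi_F|^2)\,dm .$$ Consequently, $$\int_{\mathbb T}w_s|\Phi_F-\Phi_T|^2\,dm\le2c\delta,\qquad \|\Phi_F-\Phi_T\|_{L^2}^2\le\frac{2c\delta}{(1-s)^2}.$$ In particular, for fixed $p$ and $\Lambda$, the boundary functions of every normalized maximizing sequence (a sequence $(F_j)$ in $\mathcal F_{\mathbb B_H}^{\mathrm n}(p,\Lambda)$ with $\|d(F_j)_0\|\to\sup\{\|dF_0\|:F\in\mathcal F_{\mathbb B_H}^{\mathrm n}(p,\Lambda)\}$) converge in $L^2(\mathbb T,H)$ to $\Phi_T$.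
   Context: $\mathbb D$ is the open unit disk in $\mathbb C$, $\mathbb T=\partial\mathbb D$, $m$ is normalized Lebesgue measure on $\mathbb T$. A $C^2$ map $F:\mathbb D\to H$ is harmonic if $\Delta F=0$. For $\Phi\in L^1(\mathbb T,H)$ the (Bochner) Poisson integral is $P[\Phi](re^{i\theta})=\int_{\mathbb T}\frac{1-r^2}{1-2r\cos(\theta-t)+r^2}\Phi(e^{it})\,dm$. Every bounded harmonic $F:\mathbb D\to H$ has a unique (a.e.) boundary function $\Phi_F\in L^\infty(\mathbb T,H)$ with $F=P[\Phi_F]$. $\|dF_0\|$ is the operator norm of the real differential $dF_0:\mathbb R^2\to H$. Choose an orthonormal basis $e_1,e_2$ of $\Lambda$ with $p_\Lambda=ae_1$ ($e_1$ arbitrary if $a=0$). $\mathcal F_{\mathbb B_H}^{\mathrm n}(p,\Lambda)$ is the set of harmonic maps $F:\mathbb D\to\mathbb B_H$ with $F(0)=p$ and $F_x(0)=\lambda e_1$, $F_y(0)=\lambda e_2$ for some $\lambda>0$ (so $dF_0$ is conformal with image $\Lambda$ and $\lambda=\|dF_0\|$). Further, $w_s(z)=|1+sz|^2$ on $\mathbb T$, $\mathcal M_s(\zeta)=\frac{s+\zeta}{1+s\zeta}$, and $E_s^c(\zeta)=p_\perp+c\operatorname{Re}\mathcal M_s(\zeta)e_1+c\operatorname{Im}\mathcal M_s(\zeta)e_2$ for $\zeta\in\overline{\mathbb D}$. *)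

(* Defs.v *)
From HB Require Import structures.
From mathcomp Require Import all_boot all_order all_algebra.
From mathcomp Require Import complex.
From mathcomp Require Import all_classical all_reals all_analysis.
Import Order.TTheory GRing.Theory Num.Theory.
Import numFieldNormedType.Exports.

Set Implicit Arguments.
Unset Strict Implicit.
Unset Printing Implicit Defensive.

Local Open Scope classical_set_scope.
Local Open Scope ring_scope.

(* C is used in two guises: R^2, on which real differentiation takes place,
   and R[i], for complex arithmetic. The library norm of [plane R] is the sup
   norm; it only provides the topology. Euclidean lengths go through
   [Normc.normc]. *)
Notation plane R := (R^o * R^o)%type.

Definition cplx (R : realType) (z : plane R) : R[i] := Complex z.1 z.2.

Definition disk (R : realType) : set (plane R) :=
  [set z | Normc.normc (cplx z) < 1].

Definition expi (R : realType) (t : R) : plane R := (cos t, sin t).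

Section arc_measure.
Variable R : realType.

Let inv2pi_ge0 : 0 <= (2 * pi : R)^-1.
Proof. by rewrite invr_ge0 mulr_ge0 // pi_ge0. Qed.

(* Normalized Lebesgue measure on the unit circle, carried to [0, 2 pi[ by
   [expi]: the integral of f over the circle is that of [f \o expi] against
   [arc_measure]. *)
Definition arc_measure : set (measurableTypeR R) -> \bar R :=
  mscale (NngNum inv2pi_ge0)
    (mrestr lebesgue_measure (measurable_itv `[(0 : R), 2 * pi[)).

HB.instance Definition _ := Measure.on arc_measure.

Let arc_measure_setT : arc_measure setT = 1%E.
Proof.
rewrite /arc_measure /mscale /= /mrestr setTI lebesgue_measure_itv /=.
have pi0 : 0 < (2 * pi : R) by rewrite mulr_gt0 // pi_gt0.
by rewrite lte_fin pi0 sube0 -EFinM mulVf // gt_eqF.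
Qed.

HB.instance Definition _ :=
  Measure_isProbability.Build _ _ _ arc_measure arc_measure_setT.

End arc_measure.

Section bochner.
Context (d : measure_display) (T : measurableType d) (R : realType).
Context (H : normedModType R).
Variable mu : {finite_measure set T -> \bar R}.

Definition is_simple (f : T -> H) : Prop :=
  finite_set (range f) /\ forall y, measurable (f @^-1` [set y]).

Definition simple_integral (f : T -> H) : H :=
  \sum_(y \in range f) fine (mu (f @^-1` [set y])) *: y.

Definition strongly_measurable (f : T -> H) : Prop :=
  exists2 s : nat -> T -> H, (forall n, is_simple (s n)) &
    forall x, s n x @[n --> \oo] --> f x.

(* [f] is Bochner integrable, with Bochner integral [v]. *)
Definition has_bochner_integral (f : T -> H) (v : H) : Prop :=
  strongly_measurable f /\
  exists s : nat -> T -> H,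
    [/\ forall n, is_simple (s n),
        (\int[mu]_x (`|f x - s n x|)%:E)%E @[n --> \oo] --> 0%E &
        simple_integral (s n) @[n --> \oo] --> v].

End bochner.

Section disk_maps.
Context (R : realType) (H : normedModType R).
Implicit Types (U : set (plane R)) (F Phi : plane R -> H).

Definition dx : plane R := (1, 0).
Definition dy : plane R := (0, 1).

Definition C1_on U F : Prop :=
  forall z, U z -> differentiable F z /\
    forall v : plane R, {for z, continuous (fun w => 'D_v F w)}.

Definition C2_on U F : Prop :=
  C1_on U F /\ forall v : plane R, C1_on U (fun w => 'D_v F w).

Definition laplacian F (z : plane R) : H :=
  'D_dx (fun w => 'D_dx F w) z + 'D_dy (fun w => 'D_dy F w) z.

Definition harmonic F : Prop :=
  C2_on (@disk R) F /\ forall z, disk z -> laplacian F z = 0.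

Definition dnorm0 F : R :=
  sup [set `|'d F (0 : plane R) v| |
       v in [set v : plane R | Normc.normc (cplx v) <= 1]].

Definition poisson_kernel (r theta t : R) : R :=
  (1 - r ^+ 2) / (1 - 2 * r * cos (theta - t) + r ^+ 2).

Definition is_poisson_integral Phi F : Prop :=
  forall r theta : R, 0 <= r < 1 ->
    has_bochner_integral (@arc_measure R)
      (fun t => poisson_kernel r theta t *: Phi (expi t))
      (F (r * cos theta, r * sin theta)).

(* An element of L^oo(circle, H) is given by a strongly measurable,
   essentially bounded representative [Phi]; the values of [Phi] off the unit
   circle are irrelevant. *)
Definition is_boundary_function Phi F : Prop :=
  [/\ strongly_measurable (fun t : measurableTypeR R => Phi (expi t)),
      finite_norm (@arc_measure R) +oo%E (fun t => `|Phi (expi t)|) &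
      is_poisson_integral Phi F].

(* Norm of Phi - Psi in L^2(circle, H). *)
Definition L2dist Phi Psi : \bar R :=
  Lnorm (@arc_measure R) 2%:E
    (fun t => (`|Phi (expi t) - Psi (expi t)|)%:E).

Definition normalized_maps (p e1 e2 : H) : set (plane R -> H) :=
  [set F | [/\ harmonic F, (forall z, disk z -> `|F z| < 1), F 0 = p &
    exists2 l : R, 0 < l & ('D_dx F 0 = l *: e1) /\ ('D_dy F 0 = l *: e2)]].

Definition weight (s : R) (z : plane R) : R :=
  Normc.normc (1 + s%:C%C * cplx z) ^+ 2.

Definition moebius (s : R) (z : plane R) : R[i] :=
  (s%:C%C + cplx z) / (1 + s%:C%C * cplx z).

Definition moebius_disk (q e1 e2 : H) (c s : R) (z : plane R) : H :=
  q + (c * complex.Re (moebius s z)) *: e1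
    + (c * complex.Im (moebius s z)) *: e2.

Definition two_dim_subspace (L : set H) : Prop :=
  exists u v : H,
    (forall x y : R, x *: u + y *: v = 0 -> x = 0 /\ y = 0) /\
    L = [set h | exists x y : R, h = x *: u + y *: v].

Definition orthonormal_basis2 (dot : H -> H -> R) (L : set H) (e1 e2 : H) :
    Prop :=
  [/\ dot e1 e1 = 1, dot e2 e2 = 1, dot e1 e2 = 0 &
      L = [set h | exists x y : R, h = x *: e1 + y *: e2]].

End disk_maps.

(* Main.v *)
Require Import Defs.
From HB Require Import structures.
From mathcomp Require Import all_boot all_order all_algebra.
From mathcomp Require Import finmap complex.
From mathcomp Require Import all_classical all_reals all_analysis.
From mathcomp Require Import measurable_realfun.
From mathcomp Require Import ring lra.
Import Order.TTheory GRing.Theory Num.Theory.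
Import numFieldNormedType.Exports.

Set Implicit Arguments.
Unset Strict Implicit.
Unset Printing Implicit Defensive.

Local Open Scope classical_set_scope.
Local Open Scope ring_scope.

(** The competitor T = p_perp + c Re M e1 + c Im M e2 has norm one on the
    circle, because |M| = 1 there and |p_perp|^2 + c^2 = 1.  Hence, pointwise
    on the circle,

      |Phi - T|^2 + (1 - |Phi|^2) = 2 - 2 <Phi, T>,

    so the sum of the two integrals in the identity depends on Phi in an affine
    way.  The weight |1 + s z|^2 clears the denominator of the Moebius map:
    multiplied by M it becomes (s + z)(1 + s conj z), a trigonometric
    polynomial of degree one ([moebius_expi]).  Only the Fourier coefficients
    of Phi of degree at most one enter, and these are F(0), F_x(0) and F_y(0),
    which the normalization of F prescribes up to the one number
    l = |dF_0| ([boundary_moments]).  Adding up gives 2 c (c (1 - s^2) - l)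
    ([defect_integral]), and c (1 - s^2) = |dT_0|
    ([moebius_disk_normalized]).

    Vector-valued integrals are tested against fixed vectors h, which turns the
    Poisson representation of F into scalar ones ([bochner_integral_weak],
    [poisson_dot]).

    The inequalities follow once the second integral is nonnegative, that is,
    once |Phi| <= 1 almost everywhere ([boundary_norm_le1]).  This is a weak
    form of Fatou's theorem.  For each vector h the function |h| - <Phi, h> has
    nonnegative Poisson integrals, since |F| < 1.  A scalar function with this
    property is nonnegative almost everywhere ([arc_ae_ge0]): integrating its
    Poisson integrals over an interval and exchanging the integrals shows that
    it has a nonnegative integral against a kernel that converges boundedly to
    the indicator of the interval, so its means over intervals are nonnegative,
    and Lebesgue's differentiation theorem applies.  Countably many h suffice:
    the values of simple functions converging to Phi.

    The statement on maximizing sequences needs the supremum to be |dT_0|; it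
    is, because T itself is a normalized harmonic map
    ([moebius_disk_normalized]).  The defect of the sequence then tends to
    zero, and the L^2 estimate applies. *)

(** * Scalar products *)

Section scalar_product.
Context (R : realType) (H : normedModType R) (dot : {dot H for idfun}).
Implicit Types x y z : H.

Lemma dotC x y : dot x y = dot y x.
Proof. by rewrite hermC /= expr0 mul1r. Qed.

Lemma dotDl x y z : dot (x + y) z = dot x z + dot y z.
Proof. by rewrite linearDl. Qed.

Lemma dotBl x y z : dot (x - y) z = dot x z - dot y z.
Proof. by rewrite linearBl. Qed.

Lemma dotZl k x z : dot (k *: x) z = k * dot x z.
Proof. by rewrite linearZl_LR. Qed.

Lemma dotDr x y z : dot z (x + y) = dot z x + dot z y.
Proof. by rewrite linearDr. Qed.

Lemma dotBr x y z : dot z (x - y) = dot z x - dot z y.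
Proof. by rewrite linearBr. Qed.

Lemma dotZr k x z : dot z (k *: x) = k * dot z x.
Proof. by rewrite linearZr. Qed.

Hypothesis dotE : forall x : H, dot x x = `|x| ^+ 2.

(** From the positivity of the square of |y|^2 x - <x, y> y. *)
Lemma cauchy_schwarz x y : `|dot x y| <= `|x| * `|y|.
Proof.
have [->|y0] := eqVneq y 0; first by rewrite linear0r !normr0 mulr0.
have y2 : 0 < `|y| ^+ 2 by rewrite exprn_gt0 // normr_gt0.
pose w := (`|y| ^+ 2) *: x - dot x y *: y.
have : 0 <= dot w w by rewrite dotE sqr_ge0.
rewrite dotBl !dotBr !dotZl !dotZr !dotE (dotC y x) => h.
rewrite -(@ler_pXn2r _ 2) ?nnegrE ?mulr_ge0 // real_normK ?num_real // exprMn.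
rewrite -subr_ge0 -(pmulr_rge0 _ y2); apply: le_trans h _.
by rewrite le_eqVlt; apply/orP; left; apply/eqP; ring.
Qed.

Lemma cvg_dot (T : Type) (F : set_system T) {FF : Filter F} (f : T -> H) l h :
  f x @[x --> F] --> l -> dot (f x) h @[x --> F] --> dot l h.
Proof.
move=> fl; apply/cvgrPdist_le => e e0.
have d0 : 0 < e / (`|h| + 1) by rewrite divr_gt0 // ltr_wpDl.
move/cvgrPdist_le : fl => /(_ _ d0); apply: filterS => x hx.
rewrite -dotBl (le_trans (cauchy_schwarz _ _)) //.
apply: (@le_trans _ _ (e / (`|h| + 1) * (`|h| + 1))).
  by apply: ler_pM => //; rewrite lerDl.
by rewrite divfK // gt_eqF // ltr_wpDl.
Qed.

End scalar_product.

(** * Bochner integrals tested against a vector *)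

Section bochner_weak.
Context (d : measure_display) (T : measurableType d) (R : realType).
Context (H : normedModType R).

(** A simple function into H is constrained only through its fibres, so
    after composition with an arbitrary [g] preimages are finite unions of
    intersections of fibres. *)
Lemma measurable_simple2 (g : H -> H -> R) (s1 s2 : T -> H) :
  is_simple s1 -> is_simple s2 ->
  measurable_fun setT (fun t => g (s1 t) (s2 t)).
Proof.
move=> [f1 m1] [f2 m2] _ B mB; rewrite setTI.
rewrite (_ : _ @^-1` B = \bigcup_(a in range s1)
   \bigcup_(b in range s2 `&` [set b | B (g a b)])
     (s1 @^-1` [set a] `&` s2 @^-1` [set b])).
  apply: fin_bigcup_measurable => // a _.
  apply: fin_bigcup_measurable => [|b _]; first exact: finite_setIl.
  exact: measurableI.
apply/seteqP; split => [t Bt|t [a _] [b [_ Bb]] [/= sa sb]];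
  last by rewrite /= sa sb.
by exists (s1 t); [exists t | exists (s2 t); [split => //; exists t|]].
Qed.

Lemma measurable_simple (g : H -> R) (s : T -> H) :
  is_simple s -> measurable_fun setT (g \o s).
Proof. by move=> ss; exact: (measurable_simple2 (fun a _ => g a) ss ss). Qed.

Variable mu : {finite_measure set T -> \bar R}.

Lemma simple_comp_expand (g : H -> R) (s : T -> H) t : finite_set (range s) ->
  g (s t) = \sum_(y <- fset_set (range s)) g y * \1_(s @^-1` [set y]) t.
Proof.
move=> fs; have st : s t \in fset_set (range s).
  by rewrite in_fset_set // inE; exists t.
rewrite (big_fsetD1 (s t)) //= indicE mem_set // mulr1.
rewrite big1_seq ?addr0 // => y /andP[_].
rewrite in_fsetD1 => /andP[/eqP yst _].

by rewrite indicE memNset ?mulr0 // => /esym.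
Qed.

Lemma integrable_simple (g : H -> R) (s : T -> H) : is_simple s ->
  mu.-integrable setT (EFin \o (g \o s)) /\
  \int[mu]_t g (s t) = \sum_(y \in range s) fine (mu (s @^-1` [set y])) * g y.
Proof.
move=> [fs ms].
have i1 y : mu.-integrable setT (EFin \o (fun t => g y * \1_(s @^-1` [set y]) t)).
  apply: (eq_integrable measurableT
    (fun t => (g y)%:E * (\1_(s @^-1` [set y]) t)%:E)%E) => //.
  by apply: integrableZl => //; apply: integrable_indic.
have E : EFin \o (g \o s) = fun t => (\sum_(y <- fset_set (range s))
    (g y * \1_(s @^-1` [set y]) t)%:E)%E.
  by apply/funext => t; rewrite /= (simple_comp_expand _ _ fs) sumEFin.
split.
  by rewrite E; apply: integrable_sum => // y _; exact: i1.
have -> : \int[mu]_t g (s t) = fine (\int[mu]_t (EFin \o (g \o s)) t)%E by [].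
rewrite E integral_sum //.
rewrite fsbig_finite //= -sum_fine; last first.
  by move=> y _; apply: integrable_fin_num => //; exact: i1.
apply: eq_bigr => y _.
rewrite -/(Rintegral _ _ _) RintegralZl //; last exact: integrable_indic.
by rewrite mulrC /Rintegral integral_indic // setIT.
Qed.

Variable dot : {dot H for idfun}.
Hypothesis dotE : forall x : H, dot x x = `|x| ^+ 2.

Lemma dot_simple_integral (s : T -> H) h : is_simple s ->
  dot (simple_integral mu s) h = \int[mu]_t dot (s t) h.
Proof.
move=> ss; have [_ ->] := integrable_simple (fun y => dot y h) ss.
rewrite /simple_integral !fsbig_finite //=; [|exact: ss.1..].
by elim/big_ind2: _ => [|x1 x2 y1 y2 <- <-|y _]; rewrite ?linear0l ?dotDl ?dotZl.
Qed.

Lemma strongly_measurable_norm (f : T -> H) :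
  strongly_measurable f -> measurable_fun setT (fun t => `|f t|).
Proof.
move=> [s ss sf].
apply: (measurable_fun_cvg (h := fun n t => `|s n t|)).
  by move=> n; exact: (measurable_simple _ (ss n)).
by move=> t _; apply: cvg_norm; exact: sf.
Qed.

Lemma strongly_measurable_dot (f : T -> H) h :
  strongly_measurable f -> measurable_fun setT (fun t => dot (f t) h).
Proof.
move=> [s ss sf].
apply: (measurable_fun_cvg (h := fun n t => dot (s n t) h)).
  by move=> n; exact: (measurable_simple (fun y => dot y h) (ss n)).
by move=> t _; apply: cvg_dot => //; exact: sf.
Qed.

Lemma strongly_measurableB_norm (f s : T -> H) :
  strongly_measurable f -> is_simple s ->
  measurable_fun setT (fun t => `|f t - s t|).
Proof.
move=> [u us uf] ss.
apply: (measurable_fun_cvg (h := fun n t => `|u n t - s t|)).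
  by move=> n; exact: (measurable_simple2 (fun a b => `|a - b|) (us n) ss).
by move=> t _; apply: cvg_norm; apply: cvgB; [exact: uf|exact: cvg_cst].
Qed.

(** For simple functions this is linearity of finite sums; it passes to the
    limit because <f - s n, h> is bounded by |h| |f - s n|, whose integral
    tends to zero. *)
Lemma bochner_integral_weak (f : T -> H) v h : has_bochner_integral mu f v ->
  mu.-integrable setT (EFin \o (fun t => dot (f t) h)) /\
  \int[mu]_t dot (f t) h = dot v h.
Proof.
move=> [mf [s [ss sf sv]]].
have mfs n := strongly_measurableB_norm mf (ss n).
have mfh := strongly_measurable_dot h mf.
have ish n := (integrable_simple (fun y => dot y h) (ss n)).1.
have dle t n : `|dot (f t) h - dot (s n t) h| <= `|h| * `|f t - s n t|.
  by rewrite -dotBl mulrC; exact: cauchy_schwarz.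
have ifs : \forall n \near \oo,
    mu.-integrable setT (EFin \o (fun t => `|h| * `|f t - s n t|)).
  have : \forall n \near \oo, (\int[mu]_x (`|f x - s n x|)%:E < 1)%E.
    move: sf => /fine_cvgP[fn /cvgrPdist_lt/(_ 1 ltr01)].
    apply: filterS2 fn => n fn /=; rewrite sub0r normrN => h1.
    by rewrite -(fineK fn) lte_fin (le_lt_trans (ler_norm _)).
  apply: filterS => n h1.
  apply: (eq_integrable measurableT
    (fun t => (`|h|)%:E * (`|f t - s n t|)%:E)%E) => //.
  apply: integrableZl => //; apply/integrableP; split; first exact/measurable_EFinP.
  under eq_integral do rewrite /= normr_id.
  exact: lt_trans h1 (ltry _).
have ifh : mu.-integrable setT (EFin \o (fun t => dot (f t) h)).
  have [N _ /(_ N (leqnn N)) iN] := ifs.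
  have iD := integrableD measurableT (integrable_norm (ish N)) iN.
  apply: le_integrable iD => //; first exact/measurable_EFinP.
  move=> t _ /=; rewrite lee_fin [leRHS]ger0_norm; last first.
    by rewrite addr_ge0 // mulr_ge0.
  have := ler_normD (dot (s N t) h) (dot (f t) h - dot (s N t) h).
  by rewrite [dot (s N t) h + _]addrC subrK => /le_trans; apply; rewrite lerD2l.
split=> //.
have vn : dot (simple_integral mu (s n)) h @[n --> \oo] --> dot v h.
  exact: cvg_dot.
apply: (cvg_unique _ _ vn) => //.
have cv0 : `|h| * fine (\int[mu]_x (`|f x - s n x|)%:E)%E @[n --> \oo] --> 0.
  by rewrite -[X in _ --> X](mulr0 `|h|); apply: cvgMr; move/fine_cvgP: sf => [].
apply/cvgrPdist_le => e e0.
have /fine_cvgP[fn _] := sf.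
move/cvgrPdist_le : cv0 => /(_ _ e0); apply: filterS3 ifs fn => n iN fn.
rewrite sub0r normrN; apply: le_trans.
have iB : mu.-integrable setT (EFin \o (fun t => dot (f t) h - dot (s n t) h)).
  by apply: eq_integrable (integrableB measurableT ifh (ish n)) => //.
rewrite dot_simple_integral // -RintegralB //; last exact: ish.
apply: le_trans (le_normr_Rintegral measurableT iB) _.
apply: le_trans (ler_norm _).
have -> : `|h| * fine (\int[mu]_x (`|f x - s n x|)%:E)%E
  = \int[mu]_x (`|h| * `|f x - s n x|).
  rewrite /Rintegral; under [in RHS]eq_integral do rewrite EFinM.
  rewrite ge0_integralZl //; last exact/measurable_EFinP.
  by rewrite fineM.
apply: le_Rintegral => //.
exact: integrable_norm.
Qed.

End bochner_weak.

(** * Normalized arc length *)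

Section circle.
Context {R : realType}.
Local Notation m := (@arc_measure R).
Local Notation leb := (@lebesgue_measure R).
Local Notation D := [set` `[0 : R, 2 * pi[].

Lemma twopi_gt0 : 0 < 2 * pi :> R.
Proof. by rewrite mulr_gt0 // pi_gt0. Qed.

Lemma ge0_arc_integral (A : set (measurableTypeR R)) f :
  measurable A -> A `<=` D -> measurable_fun A f ->
  (forall x, A x -> (0 <= f x)%E) ->
  (\int[m]_(x in A) f x = ((2 * pi)^-1)%:E * \int[leb]_(x in A) f x)%E.
Proof.
move=> mA AD mf f0; rewrite /arc_measure ge0_integral_mscale //.
congr (_ * _)%E; apply: eq_measure_integral => B mB BA.
by rewrite /= /mrestr setIidl //; exact: subset_trans BA AD.
Qed.

Lemma lebesgue_integrable_of_arc (A : set (measurableTypeR R)) f :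
  measurable A -> A `<=` D -> m.-integrable A f -> leb.-integrable A f.
Proof.
move=> mA AD /integrableP[mf foo]; apply/integrableP; split => //.
move: foo; rewrite ge0_arc_integral //; last exact: measurableT_comp.
rewrite !ltey; apply: contra_neq => /= ->.
by rewrite gt0_muley // lte_fin invr_gt0 twopi_gt0.
Qed.

Lemma arc_integral (A : set (measurableTypeR R)) f :
  measurable A -> A `<=` D -> m.-integrable A f ->
  (\int[m]_(x in A) f x = ((2 * pi)^-1)%:E * \int[leb]_(x in A) f x)%E.
Proof.
move=> mA AD fi; have fl := lebesgue_integrable_of_arc mA AD fi.
have mf := measurable_int _ fl.
rewrite integralE [in RHS]integralE muleBr //; last first.
  by rewrite fin_num_adde_defr // integrable_pos_fin_num.
by rewrite !ge0_arc_integral //;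
  [exact: measurable_funeneg|exact: measurable_funepos].
Qed.

Lemma measurable_arc : measurable (D : set (measurableTypeR R)).
Proof. exact: measurable_itv. Qed.

Lemma Rintegral_arc_cst (c : R) : \int[m]_t c = c.
Proof.
rewrite Rintegral_cst //.
by rewrite (_ : fine _ = 1) ?mulr1 //; exact: (congr1 fine (probability_setT m)).
Qed.

Lemma arc_measure_setC : m (~` D) = 0%E.
Proof. by rewrite /arc_measure /= /mscale /= /mrestr setICl measure0 mule0. Qed.

(** Integrals over the whole line against arc length only see one period; on
    subsets of that period arc length is a multiple of Lebesgue measure, which
    makes [arc_integral] applicable. *)
Lemma arc_integral_restrict f : m.-integrable setT f ->
  (\int[m]_x f x = \int[m]_(x in D) f x)%E.
Proof.
move=> fi; have mD := measurable_arc.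
have mN : measurable (~` D : set (measurableTypeR R)) by exact: measurableC.
by rewrite (negligible_integral mN measurableT fi arc_measure_setC) setTD setCK.
Qed.

Lemma bounded_arc_integrable (f : R -> R) (M : R) : measurable_fun setT f ->
  (forall x, `|f x| <= M) -> m.-integrable setT (EFin \o f).
Proof.
move=> mf fM; apply: measurable_bounded_integrable => //.
  by apply: (le_lt_trans (probability_le1 _ measurableT)); rewrite ltry.
exists M; split; first exact: num_real.
by move=> y My x _; exact: le_trans (fM x) (ltW My).
Qed.

Lemma continuous_measurable (f : R -> R) : continuous f ->
  measurable_fun setT (f : measurableTypeR R -> R).
Proof. by move=> cf; exact: continuous_measurable_fun. Qed.

Lemma arc_FTC (f F : R -> R) : m.-integrable setT (EFin \o f) ->
  continuous f -> (forall x : R, is_derive x 1 F (f x)) ->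
  \int[m]_t f t = (2 * pi)^-1 * (F (2 * pi) - F 0).
Proof.
move=> fi cf dF; rewrite /Rintegral arc_integral_restrict //.
have mD := measurable_arc.
rewrite arc_integral //; last exact: integrableS fi.
have cF : continuous F.
  move=> x; apply: differentiable_continuous; apply/derivable1_diffP.
  exact: (@ex_derive _ _ _ _ _ _ _ (dF x)).
rewrite integral_itv_bndo_bndc; last first.
  by apply/measurable_EFinP; apply: measurable_funTS; exact: continuous_measurable.
rewrite (continuous_FTC2 (F := F)) ?twopi_gt0 //.
- exact: continuous_subspaceT.
- split => [x _||]; first exact: (@ex_derive _ _ _ _ _ _ _ (dF x)).
  + by apply: cvg_at_right_filter; exact: cF.
  + by apply: cvg_at_left_filter; exact: cF.
- by move=> x _; rewrite derive1E; exact: derive_val.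
Qed.

End circle.

(** * The Poisson kernel *)

Section poisson.
Context {R : realType}.
Local Notation m := (@arc_measure R).
Local Notation leb := (@lebesgue_measure R).
Local Notation D := [set` `[0 : R, 2 * pi[].

(** The translation by [x] costs nothing: the antiderivative is
    2 pi-periodic. *)
Lemma arc_cos (k : nat) (x : R) : (0 < k)%N ->
  \int[m]_t cos (k%:R * (t - x)) = 0.
Proof.
move=> k0; have k0' : k%:R != 0 :> R by rewrite pnatr_eq0 -lt0n.
have cc : continuous (fun t : R => cos (k%:R * (t - x))).
  move=> t; apply: continuous_comp; last exact: continuous_cos.
  by apply: cvgMr; apply: cvgB => //; exact: cvg_cst.
pose F (t : R) := k%:R^-1 * sin (k%:R * (t - x)).
have dF (t : R) : is_derive t 1 F (cos (k%:R * (t - x))).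
  apply: is_derive_eq; rewrite /GRing.scale /=.
  by rewrite subr0 mulr1 mulrCA mulVf // mulr1.
have ic : m.-integrable setT (EFin \o (fun t => cos (k%:R * (t - x)))).
  apply: (@bounded_arc_integrable _ _ 1) => [|t]; last exact: cos_max.
  exact: continuous_measurable.
rewrite (arc_FTC ic cc dF) /F.
have -> : k%:R * (2 * pi - x) = k%:R * (0 - x) + (pi *+ 2) *+ k.
  by rewrite -mulr_natl -[pi *+ 2]mulr_natl; ring.
have -> (y : R) j : sin (y + (pi *+ 2) *+ j) = sin y.
  elim: j => [|j IH]; first by rewrite mulr0n addr0.
  by rewrite mulrSr addrA sinD2pi.
by rewrite subrr mulr0.
Qed.

Lemma poisson_denom_ge (r u : R) : 0 <= r < 1 ->
  (1 - r) ^+ 2 <= 1 - 2 * r * cos u + r ^+ 2.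
Proof.
move=> /andP[r0 r1]; have := cos_le1 u; nra.
Qed.

Lemma poisson_denom_gt0 (r u : R) : 0 <= r < 1 -> 0 < 1 - 2 * r * cos u + r ^+ 2.
Proof.
move=> rr; apply: lt_le_trans (poisson_denom_ge u rr).
by rewrite exprn_gt0 // subr_gt0; case/andP: rr.
Qed.

Lemma poisson_kernel_ge0 (r x t : R) : 0 <= r < 1 -> 0 <= poisson_kernel r x t.
Proof.
move=> rr; rewrite /poisson_kernel divr_ge0 //;
  last exact: ltW (poisson_denom_gt0 _ rr).
by case/andP: rr => r0 r1; rewrite subr_ge0 expr_le1 // ltW.
Qed.

Lemma poisson_kernel_le (r x t : R) : 0 <= r < 1 ->
  poisson_kernel r x t <= (1 - r) ^- 2.
Proof.
move=> rr; have dg := poisson_denom_ge (x - t) rr.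
case/andP: rr => r0 r1.
have r2 : 0 < (1 - r) ^+ 2 by rewrite exprn_gt0 // subr_gt0.
rewrite /poisson_kernel -[leRHS]mul1r ler_pM ?invr_ge0 //.
- by rewrite subr_ge0 expr_le1 // ltW.
- exact: le_trans (ltW r2) dg.
- by rewrite gerBl sqr_ge0.
- by rewrite lef_pV2 // posrE // (lt_le_trans r2).
Qed.

Lemma continuous_poisson_kernel (r x : R) : 0 <= r < 1 ->
  continuous (poisson_kernel r x).
Proof.
move=> rr t; apply: cvgMr; apply: cvgV.
  by rewrite gt_eqF // poisson_denom_gt0.
apply: cvgD; last exact: cvg_cst.
apply: cvgB; first exact: cvg_cst.
apply: cvgMr; apply: continuous_comp; last exact: continuous_cos.
by apply: cvgB => //; exact: cvg_cst.
Qed.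

Lemma poisson_kernelC (r x t : R) : poisson_kernel r x t = poisson_kernel r t x.
Proof. by rewrite /poisson_kernel -cosN opprB. Qed.

Lemma poisson_kernel_integrable (r x : R) : 0 <= r < 1 ->
  m.-integrable setT (EFin \o poisson_kernel r x).
Proof.
move=> rr; apply: (@bounded_arc_integrable _ _ ((1 - r) ^- 2)) => [|t].
  exact: continuous_measurable (continuous_poisson_kernel rr).
by rewrite ger0_norm ?poisson_kernel_ge0 // poisson_kernel_le.
Qed.

(** The partial sums of the Fourier series of the Poisson kernel. *)
Definition poisson_sum (r x : R) N t :=
  1 + 2 * \sum_(k < N) r ^+ k.+1 * cos (k.+1%:R * (t - x)).

(** The product telescopes because
    2 cos u cos (k u) = cos ((k + 1) u) + cos ((k - 1) u). *)
Lemma poisson_sum_telescope (r x : R) N t :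
  (1 - 2 * r * cos (t - x) + r ^+ 2) * poisson_sum r x N t =
  1 - r ^+ 2 - 2 * r ^+ N.+1 * cos (N.+1%:R * (t - x))
  + 2 * r ^+ N.+2 * cos (N%:R * (t - x)).
Proof.
elim: N => [|N IH].
  rewrite /poisson_sum big_ord0 mulr0 addr0 mulr1 mul0r cos0 !mul1r expr1; ring.
have -> : poisson_sum r x N.+1 t =
    poisson_sum r x N t + 2 * (r ^+ N.+1 * cos (N.+1%:R * (t - x))).
  by rewrite /poisson_sum big_ord_recr /= mulrDr addrA.
rewrite mulrDr IH.
move: (t - x) => u.
have -> : N%:R * u = N.+1%:R * u - u by rewrite -[N.+1]addn1 natrD; ring.
have -> : N.+2%:R * u = N.+1%:R * u + u by rewrite -[N.+2]addn1 natrD; ring.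
rewrite cosB cosD !exprS; ring.
Qed.

Lemma poisson_sum_integral (r x : R) N :
  m.-integrable setT (EFin \o poisson_sum r x N) /\
  \int[m]_t poisson_sum r x N t = 1.
Proof.
have i1 k : m.-integrable setT (EFin \o (fun t => cos (k%:R * (t - x)))).
  apply: (@bounded_arc_integrable _ _ 1) => [|t]; last exact: cos_max.
  apply: continuous_measurable => t.
  apply: continuous_comp; last exact: continuous_cos.
  by apply: cvgMr; apply: cvgB => //; exact: cvg_cst.
elim: N => [|N [iN IN]].
  have -> : poisson_sum r x 0 = cst 1.
    by apply/funext => t; rewrite /poisson_sum big_ord0 mulr0 addr0.
  split; first exact: finite_measure_integrable_cst.
  exact: Rintegral_arc_cst.
have -> : poisson_sum r x N.+1 =
    fun t => poisson_sum r x N t + 2 * r ^+ N.+1 * cos (N.+1%:R * (t - x)).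
  by apply/funext => t; rewrite /poisson_sum big_ord_recr /= mulrDr addrA !mulrA.
have i2 : m.-integrable setT
    (EFin \o (fun t => 2 * r ^+ N.+1 * cos (N.+1%:R * (t - x)))).
  by apply: eq_integrable (integrableZl measurableT (2 * r ^+ N.+1) (i1 N.+1)).
split; first by apply: eq_integrable (integrableD measurableT iN i2).
by rewrite RintegralD // RintegralZl // IN arc_cos // mulr0 addr0.
Qed.

Lemma poisson_sum_dist (r x : R) N t : 0 <= r < 1 ->
  `|poisson_kernel r x t - poisson_sum r x N t| <= 4 * (1 - r) ^- 2 * r ^+ N.
Proof.
move=> rr; have [r0 r1] := andP rr.
have D0 := poisson_denom_gt0 (t - x) rr; have Dge := poisson_denom_ge (t - x) rr.
have r2 : 0 < (1 - r) ^+ 2 by rewrite exprn_gt0 // subr_gt0.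
have rN : 0 <= r ^+ N by rewrite exprn_ge0.
set K := 1 - _ + _ in D0 Dge.
have KP : K * (poisson_kernel r x t - poisson_sum r x N t) =
    2 * r ^+ N.+1 * cos (N.+1%:R * (t - x)) - 2 * r ^+ N.+2 * cos (N%:R * (t - x)).
  rewrite mulrBr poisson_sum_telescope poisson_kernelC /poisson_kernel.
  by rewrite mulrCA divff ?gt_eqF //; ring.
have : K * `|poisson_kernel r x t - poisson_sum r x N t| <= 4 * r ^+ N.
  rewrite -{1}(gtr0_norm D0) -normrM KP !exprS.
  have := cos_max (N.+1%:R * (t - x)); have := cos_max (N%:R * (t - x)).
  move: (cos _) (cos _) => a b; rewrite (ler_norml a) (ler_norml b).
  move=> /andP[a1 a2] /andP[b1 b2].
  rewrite [X in `|X|](_ : _ = r ^+ N * (2 * r * a - 2 * r * r * b)); last by ring.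
  rewrite normrM (ger0_norm rN) mulrC ler_wpM2r // ler_norml.
  by apply/andP; split; nra.
move=> /(le_trans _) h; rewrite mulrAC ler_pdivlMr // mulrC; apply: h.
by rewrite ler_wpM2r.
Qed.

(** The partial sums have integral one and converge uniformly to the kernel. *)
Lemma poisson_kernel_integral (r x : R) : 0 <= r < 1 ->
  \int[m]_t poisson_kernel r x t = 1.
Proof.
move=> rr; have [r0 r1] := andP rr.
have iP := poisson_kernel_integrable x rr.
have bound N : `|\int[m]_t poisson_kernel r x t - 1| <= 4 * (1 - r) ^- 2 * r ^+ N.
  have [iQ IQ] := poisson_sum_integral r x N.
  have iPQ : m.-integrable setT
      (EFin \o (fun t => poisson_kernel r x t - poisson_sum r x N t)).
    by apply: eq_integrable (integrableB measurableT iP iQ).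
  rewrite -[X in `|_ - X|]IQ -RintegralB //.
  apply: le_trans (le_normr_Rintegral measurableT iPQ) _.
  have iC : m.-integrable setT (EFin \o cst (4 * (1 - r) ^- 2 * r ^+ N)).
    exact: finite_measure_integrable_cst.
  apply: le_trans (le_Rintegral measurableT (integrable_norm iPQ) iC _) _.
    by move=> t _ /=; exact: poisson_sum_dist.
  by rewrite Rintegral_arc_cst.
apply/eqP; rewrite -subr_eq0 -normr_le0; apply/ler_addgt0Pr => e e0.
have : 4 * (1 - r) ^- 2 * r ^+ n @[n --> \oo] --> 4 * (1 - r) ^- 2 * 0.
  by apply: cvgMr; apply: cvg_expr; rewrite ger0_norm.
rewrite mulr0 => /cvgrPdist_le/(_ _ e0)[N _ /(_ N (leqnn N))].
rewrite sub0r normrN add0r => /(le_trans (ler_norm _)); exact: le_trans.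
Qed.

End poisson.

(** * Poisson kernels averaged over an interval *)

Section approximate_identity.
Context {R : realType}.
Local Notation m := (@arc_measure R).
Local Notation leb := (@lebesgue_measure R).
Local Notation D := [set` `[0 : R, 2 * pi[].

Lemma cos_lt1 (d : R) : 0 < d <= pi -> cos d < 1.
Proof.
move=> /andP[d0 dpi]; rewrite -(cos0 R) ltr_cos //.
  by rewrite in_itv /= lexx pi_ge0.
by rewrite in_itv /= dpi ltW.
Qed.

Lemma cos_far (d u : R) : 0 < d <= pi -> d <= `|u| <= 2 * pi - d -> cos u <= cos d.
Proof.
move=> /andP[d0 dpi] /andP[du ud]; rewrite -(cos_norm u) leNgt.
have dI : d \in `[0, pi] by rewrite in_itv /= dpi ltW.
have [up|pu] := leP `|u| pi.
  rewrite ltr_cos //; first by rewrite -leNgt.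
  by rewrite in_itv /= up normr_ge0.
have -> : cos `|u| = cos (2 * pi - `|u|).
  by rewrite -[RHS]cosN opprB -(cosD2pi (`|u| - 2 * pi)) mulr_natl subrK.
rewrite ltr_cos //; first by rewrite -leNgt; lra.
by rewrite in_itv /=; apply/andP; split; lra.
Qed.

(** Away from the diagonal of the circle the kernel is O(1 - r): there
    1 - 2 r cos u + r^2 >= 2 r (1 - cos d). *)
Lemma poisson_kernel_far (r d x t : R) : 2^-1 <= r < 1 -> 0 < d <= pi ->
  d <= `|x - t| <= 2 * pi - d ->
  poisson_kernel r x t <= 2 * (1 - r) / (1 - cos d).
Proof.
move=> /andP[r12 r1] dd xt; have r0 : 0 <= r by lra.
have rr : 0 <= r < 1 by rewrite r0.
have cd := cos_lt1 dd; have cu := cos_far dd xt.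
have D0 := poisson_denom_gt0 (x - t) rr.
rewrite /poisson_kernel ler_pdivrMr // mulrAC ler_pdivlMr ?subr_gt0 //.
move: (cos d) (cos (x - t)) cd cu D0 => c k cd cu D0.
have hK : 1 - c <= 1 - 2 * r * k + r ^+ 2 by nra.
have h1 : (1 - r) * ((1 + r) * (1 - c)) <= (1 - r) * (2 * (1 - c)).
  by rewrite ler_wpM2l ?ler_wpM2r //; lra.
have h2 : (1 - r) * (2 * (1 - c)) <= (1 - r) * (2 * (1 - 2 * r * k + r ^+ 2)).
  by rewrite ler_wpM2l ?ler_wpM2l //; lra.
lra.
Qed.

Definition arc_kernel (A : set (measurableTypeR R)) (r t : R) : R :=
  \int[m]_(x in A) poisson_kernel r x t.

Lemma poisson_kernelC_fun (r t : R) :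
  (fun x => poisson_kernel r x t) = poisson_kernel r t.
Proof. by apply/funext => x; rewrite poisson_kernelC. Qed.

Lemma poisson_kernel_integrable2 (A : set (measurableTypeR R)) (r t : R) :
  measurable A -> 0 <= r < 1 ->
  m.-integrable A (EFin \o (fun x => poisson_kernel r x t)).
Proof.
move=> mA rr; rewrite poisson_kernelC_fun.
by apply: integrableS (poisson_kernel_integrable t rr).
Qed.

Lemma arc_kernel_ge0 A (r t : R) : 0 <= r < 1 -> 0 <= arc_kernel A r t.
Proof. by move=> rr; apply: Rintegral_ge0 => x _; exact: poisson_kernel_ge0. Qed.

Lemma arc_kernelD A (r t : R) : measurable A -> A `<=` D -> 0 <= r < 1 ->
  arc_kernel A r t + arc_kernel (D `\` A) r t = 1.
Proof.
move=> mA AD rr; have mD := @measurable_arc R.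
have mDA : measurable (D `\` A : set (measurableTypeR R)) by exact: measurableD.
rewrite /arc_kernel -Rintegral_setU //.
- rewrite setDUK // poisson_kernelC_fun.
  transitivity (\int[m]_x poisson_kernel r t x);
    last exact: poisson_kernel_integral.
  by congr fine; apply/esym/arc_integral_restrict; exact: poisson_kernel_integrable.
- by rewrite setDUK //; exact: poisson_kernel_integrable2.
- by apply/disj_setPRL => x [].
Qed.

Lemma arc_kernel_le A (r t C : R) : measurable A -> 0 <= r < 1 -> 0 <= C ->
  (forall x, A x -> poisson_kernel r x t <= C) -> arc_kernel A r t <= C.
Proof.
move=> mA rr C0 PC.
apply: (@le_trans _ _ (\int[m]_(x in A) cst C x)).
  apply: le_Rintegral => //; first exact: poisson_kernel_integrable2.
  exact: finite_measure_integrable_cst.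
rewrite Rintegral_cst // ler_piMr // -[1]/(fine 1%E) fine_le //.
  exact: fin_num_measure.
exact: probability_le1.
Qed.

(** The deviation of the averaged kernel from the indicator is an integral of
    the kernel over points at circular distance at least [d] from [t]: over the
    interval itself if [t] lies outside, over its complement if [t] lies
    inside.  The bounds [d <= a] and [b <= 2 * pi - d] keep the distance away
    from a full turn as well. *)
Lemma arc_kernel_near (a b d r t : R) : 0 < a -> b < 2 * pi -> t \in D ->
  0 < d <= pi -> d <= a -> b <= 2 * pi - d -> d <= `|t - a| -> d <= `|t - b| ->
  2^-1 <= r < 1 ->
  `|arc_kernel [set` `[a, b]] r t - \1_[set` `[a, b]] t| <=
    2 * (1 - r) / (1 - cos d).
Proof.
move=> a0 b2 /set_mem; rewrite /= in_itv /= => /andP[t0 t2] dd da db dta dtb rr2.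
have rr : 0 <= r < 1 by case/andP: rr2 => ? ->; rewrite andbT; lra.
have cd := cos_lt1 dd.
have C0 : 0 <= 2 * (1 - r) / (1 - cos d).
  by rewrite divr_ge0 ?mulr_ge0 // subr_ge0 ltW //; case/andP: rr.
have mI : measurable ([set` `[a, b]] : set (measurableTypeR R)).
  exact: measurable_itv.
have ID : [set` `[a, b]] `<=` D.
  move=> x /=; rewrite !in_itv /= => /andP[ax xb]; apply/andP; split; lra.
have far x : a <= x <= b -> ~~ (a <= t <= b) -> d <= `|x - t| <= 2 * pi - d.
  move=> /andP[ax xb]; rewrite negb_and -!ltNge => tab.
  move: dta dtb; rewrite !ler_normr => /orP dta /orP dtb.
  apply/andP; split.
    apply/orP; case/orP: tab => tab.
      by left; case: dta; lra.
    by right; case: dtb; lra.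
  by rewrite ler_norml; apply/andP; split; lra.
have far' x : 0 <= x < 2 * pi -> ~~ (a <= x <= b) -> a <= t <= b ->
   d <= `|x - t| <= 2 * pi - d.
  move=> /andP[x0 x2]; rewrite negb_and -!ltNge => xab /andP[ta tb].
  move: dta dtb; rewrite !ler_normr => /orP dta /orP dtb.
  apply/andP; split.
    apply/orP; case/orP: xab => xab.
      by right; case: dta; lra.
    by left; case: dtb; lra.
  by rewrite ler_norml; apply/andP; split; lra.
rewrite indicE; have [tI|tI] := boolP (t \in [set` `[a, b]]).
  rewrite -[X in `|_ - X|](arc_kernelD t mI ID rr) opprD addNKr normrN.
  rewrite ger0_norm ?arc_kernel_ge0 //; apply: arc_kernel_le => //.
    by apply: measurableD => //; exact: measurable_arc.
  move=> x [/=]; rewrite !in_itv /= => xD /negP xI.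
  apply: poisson_kernel_far => //; apply: far' => //.
  by move/set_mem: tI; rewrite /= in_itv.
rewrite subr0 ger0_norm ?arc_kernel_ge0 //; apply: arc_kernel_le => //.
move=> x /=; rewrite in_itv /= => xI; apply: poisson_kernel_far => //.
apply: far => //; apply: contra tI => tI; apply/mem_set.
by rewrite /= in_itv.
Qed.

End approximate_identity.

(** * Functions with nonnegative Poisson integrals *)

Section means.
Context {R : realType}.
Local Notation m := (@arc_measure R).
Local Notation leb := (@lebesgue_measure R).
Local Notation D := [set` `[0 : R, 2 * pi[].

Lemma measurable_poisson_kernel2 (r : R) : 0 <= r < 1 ->
  measurable_fun setT (fun z : measurableTypeR R * measurableTypeR R =>
    poisson_kernel r z.1 z.2).
Proof.
move=> rr.
rewrite (_ : (fun z => _) = poisson_kernel r 0 \o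
    (fun z : measurableTypeR R * measurableTypeR R =>
      (z.2 - z.1 : measurableTypeR R))).
  apply: measurableT_comp.
    exact: continuous_measurable (continuous_poisson_kernel rr).
  by apply: measurable_funB.
apply/funext => -[x t] /=; rewrite /poisson_kernel.
by rewrite sub0r opprB.
Qed.

(** Fubini for the Poisson kernel, which is bounded for fixed [r], times an
    integrable function of the second variable. *)
Lemma arc_kernel_fubini (A : set (measurableTypeR R)) (r : R) (psi : R -> R) :
  measurable A -> 0 <= r < 1 -> m.-integrable setT (EFin \o psi) ->
  measurable_fun setT (arc_kernel A r) /\
  (\int[m]_t (arc_kernel A r t * psi t)%:E =
  \int[m]_(x in A) (\int[m]_t (poisson_kernel r x t * psi t))%:E)%E.
Proof.
move=> mA rr ipsi.
have mpsi : measurable_fun setT psi.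
  by apply/measurable_EFinP; exact: measurable_int ipsi.
have mP := measurable_poisson_kernel2 rr.
pose k (z : measurableTypeR R * measurableTypeR R) : R :=
  \1_A z.1 * poisson_kernel r z.1 z.2.
have mk : measurable_fun setT k.
  apply: measurable_funM => //; apply: measurableT_comp => //.
have k0 z : (0 <= (k z)%:E)%E.
  by rewrite lee_fin mulr_ge0 // poisson_kernel_ge0.
have kC z : k z <= (1 - r) ^- 2.
  rewrite /k indicE; case: (_ \in _); last by rewrite mul0r invr_ge0 sqr_ge0.
  by rewrite mul1r poisson_kernel_le.
have Kt t : (\int[m]_x (k (x, t))%:E = (arc_kernel A r t)%:E)%E.
  rewrite /arc_kernel /Rintegral fineK; last first.
    by apply: integrable_fin_num => //; exact: poisson_kernel_integrable2.
  rewrite [RHS]integral_mkcond; apply: eq_integral => x _.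
  by rewrite /k /= patchE indicE; case: (_ \in _); rewrite ?mul1r ?mul0r.
have mK : measurable_fun setT (arc_kernel A r).
  apply/measurable_EFinP.
  rewrite (_ : _ \o _ = fun t => (\int[m]_x (k (x, t))%:E)%E).
    apply: (measurable_fun_fubini_tonelli_G (fun z => (k z)%:E)) => //.
    exact/measurable_EFinP.
  by apply/funext => t; rewrite Kt.
split => //.
pose g (z : measurableTypeR R * measurableTypeR R) := (k z * psi z.2)%:E.
have mg : measurable_fun setT g.
  apply/measurable_EFinP; apply: measurable_funM => //.
  exact: measurableT_comp.
have ig : (m \x m)%E.-integrable setT g.
  have [_] := @integrable12ltyP _ _ _ _ _ m m g mg; apply.
  have /integrableP[_ psioo] := ipsi.
  pose C := ((1 - r) ^- 2)%:E.
  have C0 : (0 <= C)%E by rewrite lee_fin invr_ge0 sqr_ge0.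
  set I := (\int[m]_x _)%E in psioo.
  apply: (@le_lt_trans _ _ (\int[m]_x (cst (C * I) x))%E); last first.
    rewrite integral_cst // lte_mul_pinfty ?mule_ge0 ?integral_ge0 //.
      by rewrite fin_numM // ge0_fin_numE // integral_ge0.
    by apply: le_lt_trans (probability_le1 m measurableT) _; rewrite ltry.
  apply: ge0_le_integral => //.
  - by move=> x _; apply: integral_ge0.
  - apply: (measurable_fun_fubini_tonelli_F (abse \o g)) => [|z];
      last exact: abse_ge0.
    exact: measurableT_comp.
  move=> x _ /=; rewrite -ge0_integralZl //; last first.
    by apply: measurableT_comp => //; exact/measurable_EFinP.
  apply: ge0_le_integral => //.
  - apply: (measurable_fun_pair2 (f := abse \o g)).
    exact: measurableT_comp.
  - by apply: measurable_funeM; apply: measurableT_comp => //; exact/measurable_EFinP.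
  move=> t _; rewrite /g /C -EFinM lee_fin normrM ler_wpM2r //.
  by rewrite ger0_norm // -lee_fin.
have Px x : m.-integrable setT (EFin \o (fun t => poisson_kernel r x t * psi t)).
  suff h : m.-integrable setT ((EFin \o poisson_kernel r x) \* (EFin \o psi))%E.
    by apply: eq_integrable h.
  apply: integrableMr => //.
    exact: continuous_measurable (continuous_poisson_kernel rr).
  exists ((1 - r) ^- 2); split; first exact: num_real.
  move=> y ry t _; apply: le_trans (ltW ry).
  by rewrite /= ger0_norm ?poisson_kernel_ge0 // poisson_kernel_le.
transitivity (\int[m]_t \int[m]_x g (x, t))%E.
  apply: eq_integral => t _; rewrite EFinM -Kt muleC -integralZl //.
    by apply: eq_integral => x _; rewrite /g EFinM muleC.
  apply: (@bounded_arc_integrable _ _ ((1 - r) ^- 2)) => [|x].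
    exact: (measurable_fun_pair1 (f := k)).
  by rewrite ger0_norm // -lee_fin.
rewrite -(@Fubini _ _ _ _ _ m m g ig) [RHS]integral_mkcond; apply: eq_integral => x _.
rewrite patchE /g /k /= indicE; case: (_ \in _); last first.
  by apply: integral0_eq => t _; rewrite !mul0r.
rewrite /Rintegral fineK.
  by apply: eq_integral => t _; rewrite mul1r.
by apply: integrable_fin_num => //; exact: Px.
Qed.

Lemma arc_measure_set1 (x : R) : m [set x] = 0%E.
Proof.
rewrite /arc_measure /= /mscale /= /mrestr.
have mx : measurable ([set x] : set (measurableTypeR R)) by exact: measurable_set1.
have mxD := measurableI _ _ mx (@measurable_arc R).
rewrite (subset_measure0 mxD mx) ?mule0 //.
exact: lebesgue_measure_set1.
Qed.

Lemma cvg_radius : (1 - (n.+2%:R)^-1 : R) @[n --> \oo] --> (1 : R).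
Proof.
rewrite -[X in _ --> X]subr0; apply: cvgB; first exact: cvg_cst.
have := @cvg_harmonic R; rewrite -cvg_shiftS.
exact.
Qed.

Lemma radius_ge n : 2^-1 <= (1 - (n.+2%:R)^-1 : R) < 1.
Proof.
have h : (n.+2%:R)^-1 <= 2^-1 :> R.
  by rewrite lef_pV2 ?posrE // ler_nat.
have h' : 0 < (n.+2%:R)^-1 :> R by rewrite invr_gt0.
by move: (_^-1) h h' => v h h'; apply/andP; split; lra.
Qed.

Lemma cvg_arc_kernel (a b t : R) : 0 < a -> b < 2 * pi -> t \in D ->
  t != a -> t != b ->
  arc_kernel [set` `[a, b]] (1 - (n.+2%:R)^-1) t @[n --> \oo]
    --> (\1_[set` `[a, b]] t : R).
Proof.
move=> a0 b2 tD ta tb.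
(* The circular distance from t to the endpoints, capped as the kernel
   estimate requires. *)
pose d := Num.min (Num.min pi a) (Num.min (2 * pi - b) (Num.min `|t - a| `|t - b|)).
have d0 : 0 < d by rewrite !lt_min pi_gt0 a0 subr_gt0 b2 !normr_gt0 !subr_eq0 ta tb.
have [[dpi da] [db dta dtb]] :
    (d <= pi /\ d <= a) /\ [/\ d <= 2 * pi - b, d <= `|t - a| & d <= `|t - b|].
  by have := lexx d; rewrite {2}/d !le_min => /andP[/andP[-> ->] /and3P[-> -> ->]].
have cd : cos d < 1 by apply: cos_lt1; rewrite d0 dpi.
have cv : 2 * (1 - (1 - (n.+2%:R)^-1 : R)) / (1 - cos d) @[n --> \oo] --> (0 : R).
  rewrite -[X in _ --> X](mul0r (1 - cos d)^-1) -[X in X * _](mulr0 2).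
  rewrite -[X in _ * X * _](subrr (1 : R)).
  apply: cvgMl; apply: cvgMr; apply: cvgB; first exact: cvg_cst.
  exact: cvg_radius.
apply/cvgrPdist_le => e e0; move/cvgrPdist_le : cv => /(_ _ e0).
apply: filterS => n.
rewrite sub0r normrN => /(le_trans (ler_norm _)); apply: le_trans.
rewrite distrC; apply: arc_kernel_near => //.
- by rewrite d0 dpi.
- lra.
- exact: radius_ge.
Qed.

(** The integral of [psi] over the interval is the limit, as r tends to 1, of
    its integrals against the averaged kernels, which are nonnegative by
    Fubini; the kernels lie between 0 and 1, so convergence is dominated by
    |psi|. *)
Lemma arc_interval_integral_ge0 (a b : R) (psi : R -> R) : 0 < a -> b < 2 * pi ->
  m.-integrable setT (EFin \o psi) ->
  (forall r x, 0 <= r < 1 -> 0 <= \int[m]_t (poisson_kernel r x t * psi t)) ->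
  (0 <= \int[m]_(t in [set` `[a, b]]) (psi t)%:E)%E.
Proof.
move=> a0 b2 ipsi Ppsi; pose A := [set` `[a, b]] : set (measurableTypeR R).
have mA : measurable A by exact: measurable_itv.
have AD : A `<=` D.
  move=> x; rewrite /A /= !in_itv /= => /andP[ax xb]; apply/andP; split; lra.
pose r n : R := 1 - (n.+2%:R)^-1.
have rr n : 0 <= r n < 1.
  by have /andP[h ->] := radius_ge n; rewrite andbT; apply: le_trans h.
have mpsi : measurable_fun setT psi.
  by apply/measurable_EFinP; exact: measurable_int ipsi.
have mf n := (arc_kernel_fubini mA (rr n) ipsi).1.
have := @dominated_convergence _ _ _ m setT measurableT
  (fun n t => (arc_kernel A (r n) t * psi t)%:E) (fun t => (\1_A t * psi t)%:E)
  (fun t => `|(psi t)%:E|)%E.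
case.
- by move=> n; apply/measurable_EFinP; apply: measurable_funM => //; exact: mf.
- by apply/measurable_EFinP; apply: measurable_funM.
- exists (~` D `|` ([set a] `|` [set b])); split.
  + apply: measurableU; last by apply: measurableU; exact: measurable_set1.
    by apply: measurableC; exact: measurable_arc.
  + have m1 (x : R) : measurable ([set x] : set (measurableTypeR R)).
      exact: measurable_set1.
    have m2 := measurableU _ _ (m1 a) (m1 b).
    have mC := measurableC (@measurable_arc R).
    have z2 : m ([set a] `|` [set b]) = 0%E.
      rewrite (measureU0 (m1 a) (m1 b) (arc_measure_set1 b)).
      exact: arc_measure_set1.
    by rewrite (measureU0 mC m2 z2); exact: arc_measure_setC.
  + move=> t /= nt; apply: contrapT => /not_orP[tD /not_orP[ta tb]]; apply: nt => _.
    apply: cvg_EFin; first exact: nearW.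
    apply: cvgMl; apply: cvg_arc_kernel => //; [|exact/eqP..].
    by apply/mem_set; apply: contrapT.
- exact: integrable_abse.
- apply: aeW => t n _; rewrite /= lee_fin normrM ger0_norm ?arc_kernel_ge0 //.
  rewrite ler_piMl // -[leRHS](arc_kernelD t mA AD (rr n)) lerDl arc_kernel_ge0 //.
move=> _ _ cv.
have -> : (\int[m]_(t in A) (psi t)%:E = \int[m]_t (\1_A t * psi t)%:E)%E.
  rewrite [LHS]integral_mkcond; apply: eq_integral => t _.
  by rewrite patchE indicE; case: (_ \in _); rewrite ?mul1r ?mul0r.
rewrite -(cvg_lim _ cv) //; apply: lime_ge; first by apply/cvg_ex; eexists; exact: cv.
apply: nearW => n.
have := (arc_kernel_fubini mA (rr n) ipsi).2; set I := (X in _ = X) => IE.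
suff : (0 <= I)%E by rewrite -IE.
apply: integral_ge0 => x _.
by rewrite lee_fin Ppsi.
Qed.

End means.

Section positivity.
Context {R : realType}.
Local Notation m := (@arc_measure R).
Local Notation leb := (@lebesgue_measure R).
Local Notation D := [set` `[0 : R, 2 * pi[].

(** At a Lebesgue point the value is the limit of the means over shrinking
    intervals centred there. *)
Lemma ae_ge0_of_itv (f : R -> R) (a0 b0 : R) : locally_integrable setT f ->
  (forall a b, a0 < a -> b < b0 ->
    (0 <= \int[leb]_(t in [set` `[a, b]]) (f t)%:E)%E) ->
  {ae leb, forall x, a0 < x < b0 -> 0 <= f x}.
Proof.
move=> lf f0.
pose E (x : R) (n : nat) : set R :=
  [set` `[x - (n.+1%:R)^-1 / 2, x + (n.+1%:R)^-1 / 2]].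
have hE x : nicely_shrinking x (E x).
  split; first by move=> n; exact: measurable_itv.
  (* An interval of half-width 1/(2n) fills half of the ball of radius 1/n. *)
  exists (2, fun n => PosNum (divr_gt0 ltr01 (ltr0Sn R n))); split => //=.
  - apply: cvg_trans (@cvg_harmonic R); apply: near_eq_cvg; apply: nearW => n.
    by rewrite /harmonic /= div1r.
  - move=> n y; rewrite /E /ball /= in_itv /= div1r.
    have : 0 < (n.+1%:R)^-1 :> R by rewrite invr_gt0.
    move: (_^-1) => v v0 /andP[h1 h2].
    by rewrite ltr_norml; apply/andP; split; lra.
  - move=> n; rewrite lebesgue_measure_ball ?divr_ge0 // /E lebesgue_measure_itv /=.
    have : 0 < (n.+1%:R)^-1 :> R by rewrite invr_gt0.
    rewrite div1r; move: (_^-1) => v v0.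
    rewrite lte_fin ifT; last lra.
    by rewrite -EFinB -EFinM lee_fin; lra.
have := lebesgue_differentiation lf.
apply: filter_app; first exact: (ae_filter_ringOfSetsType leb).
apply: aeW => x /= ptx /andP[ax xb].
have cv := nice_lebesgue_differentiation hE lf ptx.
rewrite -lee_fin -(cvg_lim _ cv) //; apply: lime_ge.
  by apply/cvg_ex; eexists; exact: cv.
have : ((n.+1%:R)^-1 : R) @[n --> \oo] --> (0 : R) by exact: cvg_harmonic.
move/cvgrPdist_lt => /(_ (Num.min (x - a0) (b0 - x))).
rewrite lt_min !subr_gt0 ax xb => /(_ isT); apply: filterS => n.
rewrite sub0r normrN ger0_norm ?invr_ge0 // lt_min => /andP[h1 h2].
have v0 : 0 < (n.+1%:R)^-1 :> R by rewrite invr_gt0.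
apply: mule_ge0; first by rewrite inve_ge0.
by apply: f0; move: (_^-1) v0 h1 h2 => v v0 h1 h2; lra.
Qed.

(** Arc length gives no mass to the complement of one period, nor to its
    endpoint 0. *)
Lemma arc_ae_of_leb (P : R -> Prop) :
  {ae leb, forall x, 0 < x < 2 * pi -> P x} -> {ae m, forall x, P x}.
Proof.
move=> [N [mN N0 PN]].
have mD := @measurable_arc R.
have m0 : measurable ([set 0] : set (measurableTypeR R)) by exact: measurable_set1.
have mC := measurableC mD.
have mC0 := measurableU _ _ mC m0.
exists ((~` D `|` [set 0]) `|` N); split.
- exact: measurableU.
- rewrite (measureU0 mC0 mN); last first.

    have h : leb (N `&` D) = 0%E.
      by apply: subset_measure0 N0 => //; exact: measurableI.
    by transitivity (((2 * pi)^-1)%:E * leb (N `&` D))%E => //; rewrite h mule0.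
  rewrite (measureU0 mC m0 (arc_measure_set1 0)); exact: arc_measure_setC.
- move=> x /= nP; have [xI|xI] := boolP (0 < x < 2 * pi).
    by right; apply: PN => /= /(_ xI).
  left; have [->|x0] := eqVneq x 0; [by right|left].
  rewrite /= in_itv /= => /andP[h1 h2]; move/negP: xI; apply.
  by rewrite h2 lt_neqAle eq_sym x0 h1.
Qed.

Lemma arc_ae_ge0 (psi : R -> R) : m.-integrable setT (EFin \o psi) ->
  (forall r x, 0 <= r < 1 -> 0 <= \int[m]_t (poisson_kernel r x t * psi t)) ->
  {ae m, forall t, 0 <= psi t}.
Proof.
move=> ipsi Ppsi; apply: arc_ae_of_leb.
have mD := @measurable_arc R.
have iD : m.-integrable D (EFin \o psi) by exact: integrableS ipsi.
have lD := lebesgue_integrable_of_arc mD (fun x => id) iD.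
pose phi := psi \_ D.
have lphi : leb.-integrable setT (EFin \o phi).
  have : leb.-integrable setT ((EFin \o psi) \_ D) by apply/(integrable_mkcond _ mD).
  by apply: eq_integrable => // x _; rewrite /phi /= !patchE; case: ifP.
have /integrableP[mphi phioo] := lphi.
have locphi : locally_integrable setT phi.
  split; [exact/measurable_EFinP|exact: openT|move=> K _ cK].
  apply: le_lt_trans phioo; apply: ge0_subset_integral => //.
    exact: compact_measurable.
  exact: (measurableT_comp (@abse_measurable R setT) mphi).
have := @ae_ge0_of_itv phi 0 (2 * pi) locphi.
have phiD x : x \in D -> phi x = psi x by rewrite /phi patchE => ->.
move=> h; have {h} : {ae leb, forall x, 0 < x < 2 * pi -> 0 <= phi x}.
  apply: h => a b a0 b2.
  pose A := [set` `[a, b]] : set (measurableTypeR R).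
  have mA : measurable A by exact: measurable_itv.
  have AD : A `<=` D.
    move=> x; rewrite /A /= !in_itv /= => /andP[ax xb]; apply/andP; split; lra.
  have iA : m.-integrable A (EFin \o psi) by exact: integrableS ipsi.
  have := arc_interval_integral_ge0 a0 b2 ipsi Ppsi.
  rewrite (arc_integral mA AD iA) pmule_rge0; last first.
    by rewrite lte_fin invr_gt0 twopi_gt0.
  congr (_ <= _)%E; apply: eq_integral => x xA /=; rewrite phiD //.
  by apply/mem_set/AD/set_mem.
apply: filter_app; first exact: (ae_filter_ringOfSetsType leb).
apply: aeW => x /= h xI; rewrite -phiD; first exact: h.
by apply/mem_set; rewrite /= in_itv /=; case/andP: xI => /ltW -> ->.
Qed.

End positivity.

(** * Boundary functions of bounded harmonic maps *)

Section boundary.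
Context {R : realType} {H : normedModType R} (dot : {dot H for idfun}).
Hypothesis dotE : forall x : H, dot x x = `|x| ^+ 2.
Local Notation m := (@arc_measure R).

Variables (F Phi : plane R -> H).
Hypothesis smPhi : strongly_measurable (fun t : measurableTypeR R => Phi (expi t)).
Hypothesis PF : is_poisson_integral Phi F.

Local Notation phi h := (fun t : R => dot (Phi (expi t)) h).

(** The representation F = P[Phi], one coordinate at a time. *)
Lemma poisson_dot h (r theta : R) : 0 <= r < 1 ->
  m.-integrable setT (EFin \o (fun t => poisson_kernel r theta t * phi h t)) /\
  \int[m]_t (poisson_kernel r theta t * phi h t) =
    dot (F (r * cos theta, r * sin theta)) h.
Proof.
move=> rr; have [+ <-] := bochner_integral_weak dotE h (PF theta rr).
have -> : (fun t => dot (poisson_kernel r theta t *: Phi (expi t)) h) =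
    (fun t => poisson_kernel r theta t * phi h t).
  by apply/funext => t; rewrite dotZl.
by [].
Qed.

Lemma poisson_kernel0 (x t : R) : poisson_kernel 0 x t = 1.
Proof. by rewrite /poisson_kernel expr0n /= mulr0 mul0r subr0 addr0 divff. Qed.

Lemma boundary_mean h : m.-integrable setT (EFin \o phi h) /\
  \int[m]_t phi h t = dot (F 0) h.
Proof.
have r0 : 0 <= (0 : R) < 1 by rewrite lexx ltr01.
have [i0 e0] := poisson_dot h 0 r0.
have E : (fun t => poisson_kernel 0 0 t * phi h t) = phi h.
  by apply/funext => t; rewrite poisson_kernel0 mul1r.
by move: i0 e0; rewrite E !mul0r => i0 e0; split.
Qed.

Lemma disk_polar (r x : R) : 0 <= r < 1 ->
  disk ((r * cos x, r * sin x) : plane R).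
Proof.
move=> /andP[r0 r1]; rewrite /disk /= !exprMn -mulrDr cos2Dsin2 mulr1.
by rewrite sqrtr_sqr ger0_norm.
Qed.

(** Each |h| - <Phi, h> has nonnegative Poisson integrals, hence is nonnegative
    almost everywhere.  Taking for h all values of a sequence of simple
    functions s n converging to Phi, one gets <Phi, s n> <= |s n| off a single
    null set, and in the limit |Phi|^2 <= |Phi|. *)
Lemma boundary_norm_le1 : (forall z, disk z -> `|F z| < 1) ->
  {ae m, forall t, `|Phi (expi t)| <= 1}.
Proof.
move=> F1.
have dle h : {ae m, forall t, phi h t <= `|h|}.
  have [ih _] := boundary_mean h.
  have ic : m.-integrable setT (EFin \o cst `|h|).
    exact: finite_measure_integrable_cst.
  have ipsi : m.-integrable setT (EFin \o (fun t => `|h| - phi h t)).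
    by apply: eq_integrable (integrableB measurableT ic ih).
  have Ppsi r x : 0 <= r < 1 ->
      0 <= \int[m]_t (poisson_kernel r x t * (`|h| - phi h t)).
    move=> rr; have [iP eP] := poisson_dot h x rr.
    have iPc : m.-integrable setT (EFin \o (fun t => poisson_kernel r x t * `|h|)).
      by apply: eq_integrable
        (integrableZr measurableT `|h| (poisson_kernel_integrable x rr)).
    under eq_Rintegral do rewrite mulrBr.
    rewrite RintegralB // eP RintegralZr //; last exact: poisson_kernel_integrable.
    rewrite poisson_kernel_integral // mul1r subr_ge0.
    apply: le_trans (ler_norm _) _; apply: le_trans (cauchy_schwarz dotE _ _) _.
    by rewrite ler_piMl // ltW // F1 //; exact: disk_polar.
  have := arc_ae_ge0 ipsi Ppsi.
  apply: filter_app; first exact: (ae_filter_ringOfSetsType m).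
  by apply: aeW => t /=; rewrite subr_ge0.
have [s ss sPhi] := smPhi.
have : {ae m, forall t, forall n, forall h, range (s n) h -> phi h t <= `|h|}.
  (* The values of s n, enumerated by k; the default 0 is harmless. *)
  pose v n k : H := nth 0 (fset_set (range (s n))) k.
  have : {ae m, forall t, forall n, forall k, phi (v n k) t <= `|v n k|}.
    by apply: ae_foralln => n; apply: ae_foralln => k; exact: dle.
  apply: filter_app; first exact: (ae_filter_ringOfSetsType m).
  apply: aeW => t /= tle n h hn.
  have hf : h \in fset_set (range (s n)).
    by rewrite in_fset_set ?inE //; exact: (ss n).1.
  by have := tle n (index h (fset_set (range (s n)))); rewrite /v nth_index.
apply: filter_app; first exact: (ae_filter_ringOfSetsType m).
apply: aeW => t /= tle.
have c1 : dot (Phi (expi t)) (s n t) @[n --> \oo] --> `|Phi (expi t)| ^+ 2.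
  rewrite -dotE; under eq_fun do rewrite dotC.
  by apply: cvg_dot.
have c2 : `|s n t| @[n --> \oo] --> `|Phi (expi t)| by apply: cvg_norm.
have : `|Phi (expi t)| ^+ 2 <= `|Phi (expi t)|.
  apply: ler_cvg_to c1 c2 _; apply: nearW => n; apply: (tle n).
  by exists t.
have := normr_ge0 (Phi (expi t)); move: (`|_|) => x; nra.
Qed.


(** The first Fourier coefficients of Phi are the first derivatives of F at the
    centre: the difference quotient of F along the direction [theta] is the
    integral of Phi against (P_r - 1) / r, and this kernel tends boundedly to
    2 cos (theta - t) as r tends to 0. *)
Lemma boundary_moment h (theta : R) : differentiable F (0 : plane R) ->
  m.-integrable setT (EFin \o (fun t => cos (theta - t) * phi h t)) /\
  2 * \int[m]_t (cos (theta - t) * phi h t) =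
    dot ('D_((cos theta, sin theta) : plane R) F 0) h.
Proof.
move=> dF; pose v : plane R := (cos theta, sin theta).
have [ih eh] := boundary_mean h.
have icos : m.-integrable setT (EFin \o (fun t => cos (theta - t) * phi h t)).
  suff : m.-integrable setT
      ((EFin \o (fun t => cos (theta - t))) \* (EFin \o phi h))%E.
    exact: eq_integrable.
  apply: integrableMr => //.
    apply: continuous_measurable => t.
    apply: continuous_comp; last exact: continuous_cos.
    by apply: cvgB => //; exact: cvg_cst.
  exists 1; split; first exact: num_real.
  by move=> y y1 t _; apply: le_trans (ltW y1); exact: cos_max.
split => //.
(* n.+2 keeps the radii at most 1/2, where the kernels below are bounded. *)
pose r n : R := (n.+2%:R)^-1.
have rr n : 0 < r n <= 2^-1.
  by rewrite /r invr_gt0 ltr0n /= lef_pV2 ?posrE // ler_nat.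
have rr1 n : 0 <= r n < 1.
  by case/andP: (rr n) => h1 h2; apply/andP; split; lra.
have r0 : r n @[n --> \oo] --> (0 : R).
  have := @cvg_harmonic R; rewrite -cvg_shiftS; exact.
have c1 : dot ((r n)^-1 *: (F (r n * cos theta, r n * sin theta) - F 0)) h
    @[n --> \oo] --> dot ('D_v F 0) h.
  apply: cvg_dot => //.
  have r0' : r n @[n --> \oo] --> (0 : R)^'.
    move=> A /= A0.
    have : \forall n \near \oo, r n != 0 -> A (r n) by exact: r0 A0.
    apply: filterS => n; apply.
    by rewrite gt_eqF //; case/andP: (rr n).
  have dv : (fun e : R => e^-1 *: ((F \o shift 0) (e *: v) - F 0)) e @[e --> 0^']
      --> 'D_v F 0 by exact: diff_derivable.
  have c0 := cvg_comp _ _ r0' dv; apply: cvg_trans c0.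
  apply: near_eq_cvg; apply: nearW => n /=.
  by rewrite addr0.
pose k n t := (2 * cos (theta - t) - 2 * r n) /
   (1 - 2 * r n * cos (theta - t) + r n ^+ 2).
have kE n t : poisson_kernel (r n) theta t = 1 + r n * k n t.
  have := poisson_denom_gt0 (theta - t) (rr1 n).
  rewrite /poisson_kernel /k; move: (cos _) (r n) => c ρ d0.
  by field; rewrite gt_eqF.
have ke n : \int[m]_t (k n t * phi h t) =
  dot ((r n)^-1 *: (F (r n * cos theta, r n * sin theta) - F 0)) h.
  have [iP eP] := poisson_dot h theta (rr1 n).
  have rn0 : r n != 0 by rewrite gt_eqF //; case/andP: (rr n).
  rewrite dotZl dotBl -eP -eh -RintegralB // -RintegralZl //; last first.
    by apply: eq_integrable (integrableB measurableT iP ih).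
  apply: eq_Rintegral => t _; rewrite kE.
  by field.
have c2 : \int[m]_t (k n t * phi h t) @[n --> \oo] -->
    \int[m]_t (2 * cos (theta - t) * phi h t).
  apply: fine_cvg; rewrite fineK; last first.
    apply: integrable_fin_num => //.
    apply: eq_integrable (integrableZl measurableT 2 icos) => // t _ /=.
    by rewrite -EFinM mulrA.
  have mphi : measurable_fun setT (phi h) by exact: strongly_measurable_dot.
  have mk n : measurable_fun setT (k n).
    apply: continuous_measurable => t.
    have cc : cos (theta - t0) @[t0 --> t] --> cos (theta - t).
      apply: continuous_comp; last exact: continuous_cos.
      by apply: cvgB => //; exact: cvg_cst.
    apply: cvgM.
      by apply: cvgB; [apply: cvgMr|exact: cvg_cst].
    apply: cvgV; first by rewrite gt_eqF // poisson_denom_gt0.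
    apply: cvgD; last exact: cvg_cst.
    by apply: cvgB; [exact: cvg_cst|apply: cvgMr].
  have := @dominated_convergence _ _ _ m setT measurableT
    (fun n t => (k n t * phi h t)%:E) (fun t => (2 * cos (theta - t) * phi h t)%:E)
    (fun t => (16%:E * `|(phi h t)%:E|)%E).
  case.
  - by move=> n; apply/measurable_EFinP; apply: measurable_funM => //; exact: mk.
  - apply/measurable_EFinP; apply: measurable_funM => //.
    apply: continuous_measurable => t; apply: cvgMr.
    apply: continuous_comp; last exact: continuous_cos.
    by apply: cvgB => //; exact: cvg_cst.
  - apply: aeW => t _; apply: cvg_EFin; first exact: nearW.
    apply: cvgMl; rewrite /k; set c := cos _.
    rewrite [X in _ --> X](_ : _ =
      (2 * c - 2 * 0) / (1 - 2 * 0 * c + 0 ^+ 2)); last first.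
      by rewrite mulr0 mul0r expr0n /= !subr0 addr0 divr1.
    apply: cvgM; first by apply: cvgB; [exact: cvg_cst|by apply: cvgMr; exact: r0].
    apply: cvgV; first by rewrite mulr0 mul0r expr0n /= subr0 addr0 oner_eq0.
    apply: cvgD; last by rewrite expr2; under eq_fun do rewrite expr2; exact: cvgM.
    by apply: cvgB; [exact: cvg_cst|apply: cvgMl; apply: cvgMr; exact: r0].
  - by apply: integrableZl => //; exact: integrable_abse.
  - apply: aeW => t n _; rewrite /= lee_fin normrM ler_wpM2r //.
    have d1 := poisson_denom_ge (theta - t) (rr1 n).
    have d0 := poisson_denom_gt0 (theta - t) (rr1 n).
    rewrite /k normrM normfV (gtr0_norm d0) ler_pdivrMr //.
    have := cos_max (theta - t); have := rr n.
    move: (cos _) (r n) d1 d0 => c v' d1 d0 /andP[v0 v1].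
    rewrite ler_norml => /andP[c2 c3].
    have h1 : 2^-1 <= 1 - v' by lra.
    have h2 : 4^-1 <= (1 - v') ^+ 2 by nra.
    by rewrite ler_norml; apply/andP; split; nra.
  by move=> _ _.
have -> : 2 * \int[m]_t (cos (theta - t) * phi h t) =
    \int[m]_t (2 * cos (theta - t) * phi h t).
  by rewrite -RintegralZl //; apply: eq_Rintegral => t _; rewrite mulrA.
move: c1; under eq_fun do rewrite -ke.
by move=> c1; apply: cvg_unique c2 c1.
Qed.

End boundary.

(** * Complex derivatives of maps of the plane *)

Section calculus.
Context {R : realType}.

(** Differentiability only depends on the germ of the map. *)
Lemma near_differentiable (V W : normedModType R) (f g : V -> W) (x : V) :
  (\forall y \near x, f y = g y) -> differentiable f x -> differentiable g x.
Proof.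
move=> fg df.
have [cf ef] := (diff_locallyP _ _).1 df.
have eg : g \o shift x = cst (g x) + 'd f x +o_ 0 id.
  apply/eqaddoP => e e0; move/eqaddoP : ef => /(_ e e0).
  have : \forall y \near 0, f (y + x) = g (y + x).
    by move: fg; rewrite (near_shift 0) /= subr0.
  apply: filterS2 => y /= fgy; rewrite !fctE /= /cst.
  by rewrite fgy (nbhs_singleton fg).
have dg : 'd g x = 'd f x :> (V -> W) by exact: diff_unique.
by apply/diff_locallyP; rewrite dg.
Qed.

Lemma is_diffV (V : normedModType R) (f df : V -> R) x :
  f x != 0 -> is_diff x f df ->
  is_diff x (fun y => (f y)^-1) (fun v => - (f x) ^- 2 * df v).
Proof.
move=> fx fd; apply: DiffDef; first exact: differentiableV.
by rewrite diffV // diff_val.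
Qed.

(** Complex differentiability at [z], with derivative [g'], in terms of the real
    differentials of the two components: multiplication by [g'] is the
    Cauchy-Riemann condition. *)
Definition holo (g : plane R -> R[i]) (z : plane R) (g' : R[i]) : Prop :=
  is_diff z (fun y => complex.Re (g y)) (fun v => complex.Re (g' * cplx v)) /\
  is_diff z (fun y => complex.Im (g y)) (fun v => complex.Im (g' * cplx v)).

Lemma ReD (a b : R[i]) : complex.Re (a + b) = complex.Re a + complex.Re b.
Proof. by case: a b => a1 a2 []. Qed.

Lemma ImD (a b : R[i]) : complex.Im (a + b) = complex.Im a + complex.Im b.
Proof. by case: a b => a1 a2 []. Qed.

Lemma ReM (a b : R[i]) : complex.Re (a * b) =
  complex.Re a * complex.Re b - complex.Im a * complex.Im b.
Proof. by case: a b => a1 a2 []. Qed.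

Lemma ImM (a b : R[i]) : complex.Im (a * b) =
  complex.Re a * complex.Im b + complex.Im a * complex.Re b.
Proof. by case: a b => a1 a2 [b1 b2] /=; rewrite [_ * b1]mulrC. Qed.

Lemma ReV (a : R[i]) : complex.Re a^-1 =
  complex.Re a * (complex.Re a ^+ 2 + complex.Im a ^+ 2)^-1.
Proof. by case: a => a1 a2. Qed.

Lemma ImV (a : R[i]) : complex.Im a^-1 =
  - complex.Im a * (complex.Re a ^+ 2 + complex.Im a ^+ 2)^-1.
Proof. by case: a => a1 a2 /=; rewrite mulNr. Qed.

Lemma holo_cst a z : holo (fun=> a) z 0.
Proof. by split; apply: is_diff_eq; apply/funext => v; rewrite mul0r. Qed.

Lemma holo_id z : holo (@cplx R) z 1.
Proof.
split.
  apply: DiffDef.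
    apply: (linear_differentiable (f := fst : plane R -> R^o)) => y.
    exact: cvg_fst.
  rewrite (diff_lin (f := fst : plane R -> R^o)); last by move=> y; exact: cvg_fst.
  by apply/funext => v; rewrite mul1r.
apply: DiffDef.
  by apply: (linear_differentiable (f := snd : plane R -> R^o)) => y; exact: cvg_snd.
rewrite (diff_lin (f := snd : plane R -> R^o)); last by move=> y; exact: cvg_snd.
by apply/funext => v; rewrite mul1r.
Qed.

Lemma holoD g h z g' h' : holo g z g' -> holo h z h' ->
  holo (fun y => g y + h y) z (g' + h').
Proof.
move=> [g1 g2] [h1 h2]; split.
  rewrite (_ : (fun y => _) =
      (fun y => complex.Re (g y)) + (fun y => complex.Re (h y))).
    by apply: is_diff_eq; apply/funext => v; rewrite !fctE mulrDl ReD.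
  by apply/funext => y; rewrite fctE ReD.
rewrite (_ : (fun y => _) =
    (fun y => complex.Im (g y)) + (fun y => complex.Im (h y))).
  by apply: is_diff_eq; apply/funext => v; rewrite !fctE mulrDl ImD.
by apply/funext => y; rewrite fctE ImD.
Qed.

Lemma holoM g h z g' h' : holo g z g' -> holo h z h' ->
  holo (fun y => g y * h y) z (g' * h z + g z * h').
Proof.
move=> [g1 g2] [h1 h2]; split.
  rewrite (_ : (fun y => _) =
      (fun y => complex.Re (g y)) * (fun y => complex.Re (h y)) -
      (fun y => complex.Im (g y)) * (fun y => complex.Im (h y))).
    apply: is_diff_eq; apply/funext => v; rewrite !fctE /=.
    rewrite /GRing.scale /= !(ReM, ImM, ReD, ImD); ring.
  by apply/funext => y; rewrite !fctE ReM.
rewrite (_ : (fun y => _) =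
    (fun y => complex.Re (g y)) * (fun y => complex.Im (h y)) +
    (fun y => complex.Im (g y)) * (fun y => complex.Re (h y))).
  apply: is_diff_eq; apply/funext => v; rewrite !fctE /=.
  rewrite /GRing.scale /= !(ReM, ImM, ReD, ImD); ring.
by apply/funext => y; rewrite !fctE ImM.
Qed.

Lemma holoV g z g' : holo g z g' -> g z != 0 ->
  holo (fun y => (g y)^-1) z (- g' * (g z)^-1 ^+ 2).
Proof.
move=> [g1 g2] gz0.
have N0 : complex.Re (g z) ^+ 2 + complex.Im (g z) ^+ 2 != 0.
  rewrite paddr_eq0 ?sqr_ge0 // !sqrf_eq0; apply: contra gz0.
  by case: (g z) => a b /= /andP[/eqP -> /eqP ->].
pose N : plane R -> R :=
  (fun y => complex.Re (g y)) ^+ 2 + (fun y => complex.Im (g y)) ^+ 2.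
have dN : is_diff z N (2 * complex.Re (g z) *: (fun v => complex.Re (g' * cplx v)) +
    2 * complex.Im (g z) *: (fun v => complex.Im (g' * cplx v))).
  by apply: is_diff_eq; rewrite !expr1.
have dV := @is_diffV _ N _ z N0 dN.
split.
  rewrite (_ : (fun y => _) = (fun y => complex.Re (g y)) * (fun y => (N y)^-1)).
    apply: is_diff_eq; apply/funext => v; rewrite !fctE /=.
    rewrite /GRing.scale /= /N !fctE !expr2 !(ReM, ImM, ReD, ImD, ReV, ImV).
    by field; exact: N0.
  by apply/funext => y; rewrite !fctE ReV.
rewrite (_ : (fun y => _) = (- fun y => complex.Im (g y)) * (fun y => (N y)^-1)).
  apply: is_diff_eq; apply/funext => v; rewrite !fctE /=.
  rewrite /GRing.scale /= /N !fctE !expr2 !(ReM, ImM, ReD, ImD, ReV, ImV).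
  by field; exact: N0.
by apply/funext => y; rewrite !fctE ImV.
Qed.

End calculus.

(** * Holomorphic functions carried into a real plane of H *)

Section holomorphic_maps.
Context {R : realType} {H : normedModType R}.

Lemma is_diff_embed (q f1 f2 : H) g z g' : holo g z g' ->
  is_diff z (fun y => q + complex.Re (g y) *: f1 + complex.Im (g y) *: f2)
    (fun v => complex.Re (g' * cplx v) *: f1 + complex.Im (g' * cplx v) *: f2).
Proof.
move=> [g1 g2].
have d1 : is_diff z ( *:%R ^~ f1 \o (fun y => complex.Re (g y)))
  ( *:%R ^~ f1 \o (fun v => complex.Re (g' * cplx v))) by exact: is_diff_comp.
have d2 : is_diff z ( *:%R ^~ f2 \o (fun y => complex.Im (g y)))
  ( *:%R ^~ f2 \o (fun v => complex.Im (g' * cplx v))) by exact: is_diff_comp.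
rewrite (_ : (fun y => _) = cst q + ( *:%R ^~ f1 \o (fun y => complex.Re (g y))) +
   ( *:%R ^~ f2 \o (fun y => complex.Im (g y)))) //.
by apply: is_diff_eq; rewrite add0r.
Qed.

Lemma disk_near (z : plane R) : disk z -> \forall y \near z, disk y.
Proof.
have E y : disk y = (y.1 * y.1 + y.2 * y.2 < 1) :> Prop.
  by rewrite /disk /= -{1}sqrtr1 ltr_sqrt ?ltr01 // !expr2.
rewrite E => hz.
have c : y.1 * y.1 + y.2 * y.2 @[y --> z] --> z.1 * z.1 + z.2 * z.2.
  by apply: cvgD; apply: cvgM; (apply: cvg_fst || apply: cvg_snd).
have : \forall y \near z, y.1 * y.1 + y.2 * y.2 < 1 by apply: cvgr_lt c _ hz.
by apply: filterS => y; rewrite E.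
Qed.

(** The directional derivative along [v] of a map with holomorphic components
    [g] is the map of the same kind with components [g' * v].  Applied twice,
    this gives all second derivatives. *)
Lemma C1_on_holo (F : plane R -> H) (q f1 f2 : H) (g g' : plane R -> R[i]) :
  (forall z, disk z -> F z = q + complex.Re (g z) *: f1 + complex.Im (g z) *: f2) ->
  (forall z, disk z -> holo g z (g' z)) ->
  (forall z, disk z -> exists g'', holo g' z g'') ->
  C1_on (@disk R) F /\ forall z v, disk z ->
    'D_v F z = complex.Re (g' z * cplx v) *: f1 + complex.Im (g' z * cplx v) *: f2.
Proof.
move=> Fg hg hg'.
have dF z : disk z -> differentiable F z.
  move=> Uz; have dG := is_diff_embed q f1 f2 (hg z Uz).
  have [dg _] := dG.
  apply: near_differentiable dg; apply: filterS (disk_near Uz) => y Uy.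
  by rewrite Fg.
have DF z v : disk z ->
    'D_v F z = complex.Re (g' z * cplx v) *: f1 + complex.Im (g' z * cplx v) *: f2.
  move=> Uz; have dG := is_diff_embed q f1 f2 (hg z Uz).
  have [dg _] := dG.
  rewrite (@near_eq_derive _ _ _ _
    (fun y => q + complex.Re (g y) *: f1 + complex.Im (g y) *: f2)).
    by rewrite deriveE // diff_val.
  by apply: filterS (disk_near Uz) => y Uy; rewrite Fg.
split => // z Uz; split; first exact: dF.
move=> v; have [g'' hg''] := hg' z Uz.
have hgv := holoM hg'' (holo_cst (cplx v) z).
have dG := is_diff_embed 0 f1 f2 hgv.
have [dg _] := dG.
apply: differentiable_continuous; apply: near_differentiable dg.
apply: filterS (disk_near Uz) => y Uy.
by rewrite add0r DF.
Qed.

(** A conformal differential multiplies Euclidean length by [l]. *)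
Lemma dnorm0E (dot : {dot H for idfun}) (dotE : forall x : H, dot x x = `|x| ^+ 2)
    (F : plane R -> H) (e1 e2 : H) (l : R) :
  dot e1 e1 = 1 -> dot e2 e2 = 1 -> dot e1 e2 = 0 -> 0 <= l ->
  differentiable F (0 : plane R) ->
  'D_(@dx R) F 0 = l *: e1 -> 'D_(@dy R) F 0 = l *: e2 -> dnorm0 F = l.
Proof.
move=> d11 d22 d12 l0 dF; rewrite !deriveE // => Fx Fy.
have dv (v : plane R) : `|'d F (0 : plane R) v| = l * Normc.normc (cplx v).
  have -> : 'd F (0 : plane R) v = l *: (v.1 *: e1 + v.2 *: e2).
    have {1}-> : v = v.1 *: @dx R + v.2 *: @dy R.
      by case: v => x y; congr (_, _) => /=; rewrite /GRing.scale /=; ring.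
    by rewrite linearD !linearZ /= Fx Fy scalerDr !scalerA !(mulrC l).
  rewrite normrZ (ger0_norm l0); congr (_ * _).
  rewrite -[LHS]ger0_norm // -sqrtr_sqr -dotE !dotDl !dotDr !dotZl !dotZr.
  rewrite d11 d22 (dotC dot e2 e1) d12 /Normc.normc /=; congr Num.sqrt; ring.
rewrite /dnorm0; apply/eqP; rewrite eq_le; apply/andP; split.
  apply: ge_sup.
    exists `|'d F (0 : plane R) 0|, 0 => //=.
    by rewrite expr0n /= addr0 sqrtr0.
  by move=> _ [v /= v1 <-]; rewrite dv ler_piMr.
apply: ub_le_sup.
  by exists l => _ [v /= v1 <-]; rewrite dv ler_piMr.
exists (@dx R) => /=; rewrite ?dv /= expr1n expr0n /= addr0 sqrtr1 //.
by rewrite mulr1.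
Qed.

End holomorphic_maps.

(** * The Moebius disk as a normalized harmonic map *)

Section moebius.
Context {R : realType}.

Lemma diskE (z : plane R) : disk z = (z.1 ^+ 2 + z.2 ^+ 2 < 1) :> Prop.
Proof. by rewrite /disk /= -{1}sqrtr1 ltr_sqrt ?ltr01. Qed.

Lemma moebius_denomE (s : R) (z : plane R) :
  1 + s%:C%C * cplx z = Complex (1 + s * z.1) (s * z.2).
Proof. by rewrite /cplx; simpc. Qed.

(** For s > 0 the pole -1/s lies outside the closed disk. *)
Lemma moebius_denom_neq0 (s : R) (z : plane R) : 0 <= s < 1 -> disk z ->
  1 + s%:C%C * cplx z != 0.
Proof.
move=> /andP[s0 s1]; rewrite diskE moebius_denomE eq_complex /= => h.
suff h' : 0 < 1 + s * z.1 by rewrite gt_eqF.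
have := sqr_ge0 z.2; move: (z.1) (z.2) h => x y h hy.
have : - 1 < x by nra.
nra.
Qed.

Lemma holo_denom (s : R) z : holo (fun y => 1 + s%:C%C * cplx y) z s%:C%C.
Proof.
have := holoD (holo_cst 1 z) (holoM (holo_cst s%:C%C z) (holo_id z)).
by rewrite add0r mul0r add0r mulr1.
Qed.

Lemma holo_moebius (s : R) z : 1 + s%:C%C * cplx z != 0 ->
  holo (moebius s) z ((1 - s ^+ 2)%:C%C * (1 + s%:C%C * cplx z)^-1 ^+ 2).
Proof.
move=> d0; have := holoM (holoD (holo_cst s%:C%C z) (holo_id z))
  (holoV (holo_denom s z) d0).
congr holo.
rewrite rmorphB rmorphXn rmorph1.
by field.
Qed.

Lemma holo_dmoebius (s : R) z : 1 + s%:C%C * cplx z != 0 ->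
  holo (fun y => (1 - s ^+ 2)%:C%C * (1 + s%:C%C * cplx y)^-1 ^+ 2) z
   ((1 - s ^+ 2)%:C%C * (- 2 * s%:C%C * (1 + s%:C%C * cplx z)^-1 ^+ 3)).
Proof.
move=> d0; have hV := holoV (holo_denom s z) d0.
have := holoM (holo_cst (1 - s ^+ 2)%:C%C z) (holoM hV hV).
congr holo.
by field.
Qed.

Lemma holo_d2moebius (s : R) z : 1 + s%:C%C * cplx z != 0 ->
  exists g'', holo (fun y =>
   ((1 - s ^+ 2)%:C%C * (- 2 * s%:C%C * (1 + s%:C%C * cplx y)^-1 ^+ 3))) z g''.
Proof.
move=> d0; have hV := holoV (holo_denom s z) d0.
eexists; apply: holoM (holo_cst _ z) _.
apply: holoM (holo_cst _ z) (holoM hV (holoM hV hV)).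
Qed.

End moebius.

Section moebius_disk.
Context {R : realType} {H : normedModType R} (dot : {dot H for idfun}).
Hypothesis dotE : forall x : H, dot x x = `|x| ^+ 2.
Variables (q e1 e2 : H) (c s : R).
Hypotheses (d11 : dot e1 e1 = 1) (d22 : dot e2 e2 = 1) (d12 : dot e1 e2 = 0).
Hypotheses (dq1 : dot q e1 = 0) (dq2 : dot q e2 = 0).
Hypotheses (c0 : 0 < c) (qc : `|q| ^+ 2 + c ^+ 2 = 1) (s01 : 0 <= s < 1).
Local Notation T := (moebius_disk q e1 e2 c s).

Lemma norm_moebius_disk z : `|T z| ^+ 2 = `|q| ^+ 2 +
  c ^+ 2 * (complex.Re (moebius s z) ^+ 2 + complex.Im (moebius s z) ^+ 2).
Proof.
rewrite -!dotE /moebius_disk !dotDl !dotDr !dotZl !dotZr.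
rewrite !(dotC dot e1 q) !(dotC dot e2 q).
rewrite (dotC dot e2 e1) d11 d22 d12 dq1 dq2; ring.
Qed.

Lemma moebius_modulus (z : plane R) : 1 + s%:C%C * cplx z != 0 ->
  (complex.Re (moebius s z) ^+ 2 + complex.Im (moebius s z) ^+ 2) *
    ((1 + s * z.1) ^+ 2 + (s * z.2) ^+ 2) = (s + z.1) ^+ 2 + z.2 ^+ 2.
Proof.
rewrite /moebius moebius_denomE ReM ImM ReV ImV /= eq_complex /= => d0.
have N0 : (1 + s * z.1) ^+ 2 + (s * z.2) ^+ 2 != 0.
  by rewrite paddr_eq0 ?sqr_ge0 // !sqrf_eq0.
by rewrite add0r; field.
Qed.

(** |1 + s z|^2 - |s + z|^2 = (1 - s^2)(1 - |z|^2) > 0. *)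
Lemma moebius_disk_lt1 z : disk z -> `|T z| < 1.
Proof.
move=> zD; have d0 := moebius_denom_neq0 s01 zD.
have := moebius_modulus d0; set M := (X in X * _); set N := (X in _ * X) => MN.
have N0 : 0 < N.
  rewrite lt_neqAle addr_ge0 ?sqr_ge0 // andbT eq_sym paddr_eq0 ?sqr_ge0 // !sqrf_eq0.
  by move: d0; rewrite moebius_denomE eq_complex.
have M1 : M < 1.
  rewrite -(ltr_pM2r N0) MN mul1r /N; move: zD; rewrite diskE.
  move: (z.1) (z.2) => x y xy; rewrite -subr_gt0.
  rewrite (_ : _ - _ = (1 - s ^+ 2) * (1 - (x ^+ 2 + y ^+ 2))); last by ring.
  by rewrite mulr_gt0 ?subr_gt0 //; case/andP: s01 => s0 s1; rewrite expr_lt1.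
rewrite -(@ltr_pXn2r _ 2) ?nnegrE // expr1n norm_moebius_disk -qc ltrD2l.
by rewrite -[ltRHS]mulr1 ltr_pM2l // exprn_gt0.
Qed.

Lemma moebius_diskE z : T z =
  q + complex.Re (moebius s z) *: (c *: e1) + complex.Im (moebius s z) *: (c *: e2).
Proof. by rewrite /moebius_disk !scalerA !(mulrC c). Qed.

Lemma moebius_disk_C1 : C1_on (@disk R) T /\ forall z v, disk z ->
  'D_v T z =
   complex.Re ((1 - s ^+ 2)%:C%C * (1 + s%:C%C * cplx z)^-1 ^+ 2 * cplx v) *: (c *: e1)
 + complex.Im ((1 - s ^+ 2)%:C%C * (1 + s%:C%C * cplx z)^-1 ^+ 2 * cplx v) *: (c *: e2).
Proof.
apply: (C1_on_holo (q := q) (g := moebius s)) => z zD; first exact: moebius_diskE.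
  exact: holo_moebius (moebius_denom_neq0 s01 zD).
eexists; exact: holo_dmoebius (moebius_denom_neq0 s01 zD).
Qed.

(** The Laplacian is the image of M'' (1 + i^2) = 0. *)
Lemma moebius_disk_harmonic : Defs.harmonic T.
Proof.
have [C1T DT] := moebius_disk_C1.
pose m2 z := (1 - s ^+ 2)%:C%C * (- 2 * s%:C%C * (1 + s%:C%C * cplx z)^-1 ^+ 3).
have C2 v : C1_on (@disk R) (fun w => 'D_v T w) /\ forall z w, disk z ->
    'D_w (fun y => 'D_v T y) z =
      complex.Re (m2 z * cplx v * cplx w) *: (c *: e1)
      + complex.Im (m2 z * cplx v * cplx w) *: (c *: e2).
  apply: (C1_on_holo (q := 0) (g := fun z =>
    (1 - s ^+ 2)%:C%C * (1 + s%:C%C * cplx z)^-1 ^+ 2 * cplx v)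
    (g' := fun z => m2 z * cplx v)) => z zD.
  - by rewrite DT // add0r.
  - have := holoM (holo_dmoebius (moebius_denom_neq0 s01 zD)) (holo_cst (cplx v) z).
    by rewrite mulr0 addr0.
  - have [g'' hg] := holo_d2moebius (moebius_denom_neq0 s01 zD).
    by eexists; exact: holoM hg (holo_cst (cplx v) z).
split; first by split => // v; exact: (C2 v).1.
move=> z zD; rewrite /laplacian (C2 _).2 // (C2 _).2 //.
move: (m2 z) => [a b]; rewrite /dx /dy /cplx /=; simpc => /=.
by rewrite addrACA -!scalerDl subrr addrC subrr !scale0r addr0.
Qed.

Lemma moebius_disk_normalized :
  normalized_maps (q + (c * s) *: e1) e1 e2 T /\
  dnorm0 T = c * (1 - s ^+ 2).
Proof.
have [C1T DT] := moebius_disk_C1.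
have D0 : disk (0 : plane R) by rewrite diskE /= expr0n /= addr0.
have l0 : 0 < c * (1 - s ^+ 2).
  by rewrite mulr_gt0 // subr_gt0; case/andP: s01 => s0 s1; rewrite expr_lt1.
have M0 : 1 + s%:C%C * cplx (0 : plane R) = 1.
  by rewrite moebius_denomE /= !mulr0 addr0.
have Dx : 'D_(@dx R) T 0 = (c * (1 - s ^+ 2)) *: e1.
  rewrite DT // M0 invr1 expr1n mulr1 /cplx /dx /=; simpc => /=.
  by rewrite scale0r addr0 scalerA mulrC.
have Dy : 'D_(@dy R) T 0 = (c * (1 - s ^+ 2)) *: e2.
  rewrite DT // M0 invr1 expr1n mulr1 /cplx /dy /=; simpc => /=.
  by rewrite scale0r add0r scalerA mulrC.
split; last first.
  apply: (dnorm0E dotE d11 d22 d12 (ltW l0)) => //.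
  exact: (C1T _ D0).1.
split; [exact: moebius_disk_harmonic|exact: moebius_disk_lt1| |].
  rewrite moebius_diskE /moebius M0 divr1 /cplx /=; simpc => /=.
  by rewrite scale0r addr0 scalerA mulrC.
by exists (c * (1 - s ^+ 2)).
Qed.

End moebius_disk.

(** * The defect identity *)
Lemma L2dist_sqr (R : realType) (H : normedModType R) (Phi Psi : plane R -> H) :
  (L2dist Phi Psi ^+ 2 =
    \int[@arc_measure R]_t (`|Phi (expi t) - Psi (expi t)| ^+ 2)%:E)%E.
Proof.
rewrite /L2dist unlock /= poweR12_sqrt; last first.
  by apply: integral_ge0 => t _; rewrite lee_fin powR_ge0.
rewrite -expe2 sqr_sqrte; last first.
  by apply: integral_ge0 => t _; rewrite lee_fin powR_ge0.
apply: eq_integral => t _.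
by rewrite normr_id powR_mulrn.
Qed.

Section has_integral.
Context {R : realType}.
Local Notation m := (@arc_measure R).

(** Integrability and value in one predicate, so that a linear combination of
    known integrals is evaluated by composing the next lemmas. *)
Definition arc_has_integral (f : R -> R) (v : R) : Prop :=
  m.-integrable setT (EFin \o f) /\ \int[m]_t f t = v.

Lemma arc_has_integralD f g u v : arc_has_integral f u -> arc_has_integral g v ->
  arc_has_integral (fun t => f t + g t) (u + v).
Proof.
move=> [fi fu] [gi gv]; split; last by rewrite RintegralD // fu gv.
by apply: eq_integrable (integrableD measurableT fi gi).
Qed.

Lemma arc_has_integralZ k f u : arc_has_integral f u ->
  arc_has_integral (fun t => k * f t) (k * u).
Proof.
move=> [fi fu]; split; last by rewrite RintegralZl // fu.
by apply: eq_integrable (integrableZl measurableT k fi).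
Qed.

Lemma arc_has_integral_cst k : arc_has_integral (fun=> k) k.
Proof.
split; last exact: Rintegral_arc_cst.
exact: (@finite_measure_integrable_cst _ _ _ m setT k).
Qed.

Lemma arc_has_integral_cos : arc_has_integral cos 0.
Proof.
split.
  apply: (@bounded_arc_integrable _ _ 1) => [|t]; last exact: cos_max.
  by apply: continuous_measurable; exact: continuous_cos.
rewrite -[RHS](@arc_cos R 1 0) //; apply: eq_Rintegral => t _.
by rewrite mul1r subr0.
Qed.

End has_integral.

Section defect.
Context {R : realType} {H : normedModType R} (dot : {dot H for idfun}).
Hypothesis dotE : forall x : H, dot x x = `|x| ^+ 2.
Local Notation m := (@arc_measure R).
Variables (q e1 e2 : H) (c s : R).
Hypotheses (d11 : dot e1 e1 = 1) (d22 : dot e2 e2 = 1) (d12 : dot e1 e2 = 0).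
Hypotheses (dq1 : dot q e1 = 0) (dq2 : dot q e2 = 0).
Hypotheses (c0 : 0 < c) (qc : `|q| ^+ 2 + c ^+ 2 = 1) (s01 : 0 <= s < 1).
Local Notation T := (moebius_disk q e1 e2 c s).
Local Notation p := (q + (c * s) *: e1).

Lemma weightE t : weight s (expi t) = 1 + s ^+ 2 + 2 * s * cos t.
Proof.
rewrite /weight moebius_denomE /Normc.normc /= sqr_sqrtr ?addr_ge0 ?sqr_ge0 //.
have := cos2Dsin2 t; move: (cos t) (sin t) => x y xy.
transitivity (1 + 2 * s * x + s ^+ 2 * (x ^+ 2 + y ^+ 2)); first by ring.
by rewrite xy; ring.
Qed.

Lemma weight_ge t : (1 - s) ^+ 2 <= weight s (expi t).
Proof.
rewrite weightE; case/andP: s01 => s0 s1; have := cos_geN1 t; nra.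
Qed.

Lemma weight_gt0 t : 0 < weight s (expi t).
Proof.
apply: lt_le_trans (weight_ge t); rewrite exprn_gt0 // subr_gt0.
by case/andP: s01.
Qed.

Lemma denom_expi t : 1 + s%:C%C * cplx (expi t) != 0.
Proof.
have := weight_gt0 t; apply: contraTneq; rewrite /weight => ->.
by rewrite Normc.normc0 expr0n /= ltxx.
Qed.

(** The real and imaginary parts of (s + z)(1 + s conj z) for |z| = 1. *)
Lemma moebius_expi t :
  weight s (expi t) * complex.Re (moebius s (expi t)) =
    2 * s + (1 + s ^+ 2) * cos t /\
  weight s (expi t) * complex.Im (moebius s (expi t)) = (1 - s ^+ 2) * sin t.
Proof.
have W : weight s (expi t) = (1 + s * cos t) ^+ 2 + (s * sin t) ^+ 2.
  by rewrite /weight moebius_denomE /Normc.normc /= sqr_sqrtr ?addr_ge0 ?sqr_ge0.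
have W0 : weight s (expi t) != 0 by rewrite gt_eqF ?weight_gt0.
rewrite W in W0 *.
rewrite /moebius moebius_denomE ReM ImM ReV ImV /=.
have := cos2Dsin2 t; move: (cos t) (sin t) W0 => x y W0 xy.
have y2 : y ^+ 2 = 1 - x ^+ 2 by rewrite -xy; ring.
split.
  transitivity ((s + x) * (1 + s * x) + s * y ^+ 2); first by field.
  by rewrite y2; ring.
by field.
Qed.

Lemma norm_moebius_expi t : `|T (expi t)| = 1.
Proof.
apply/eqP; rewrite -(@eqrXn2 _ 2) // expr1n (norm_moebius_disk dotE) //.
have W0 : weight s (expi t) != 0 by rewrite gt_eqF ?weight_gt0.
suff -> : complex.Re (moebius s (expi t)) ^+ 2 +
    complex.Im (moebius s (expi t)) ^+ 2 = 1.
  by rewrite mulr1 qc.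
apply: (mulIf W0); rewrite mul1r {1}/weight moebius_denomE /Normc.normc.
rewrite sqr_sqrtr ?addr_ge0 ?sqr_ge0 // (moebius_modulus (denom_expi t)) weightE /=.
have := cos2Dsin2 t; move: (cos t) (sin t) => x y xy.
have y2 : y ^+ 2 = 1 - x ^+ 2 by rewrite -xy; ring.
by rewrite y2; ring.
Qed.

Variables (F Phi : plane R -> H).
Hypothesis FF : normalized_maps p e1 e2 F.
Hypothesis bF : is_boundary_function Phi F.

Local Notation phi h := (fun t : R => dot (Phi (expi t)) h).
Local Notation l := (dnorm0 F).

(** The normalization of F leaves [dnorm0 F] as the only unknown among the
    Fourier coefficients of Phi of degree at most one. *)
Lemma boundary_moments h :
  [/\ arc_has_integral (phi h) (dot p h),
      arc_has_integral (fun t => cos t * phi h t) (l / 2 * dot e1 h) &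
      arc_has_integral (fun t => sin t * phi h t) (l / 2 * dot e2 h)].
Proof.
have [Fharm F1 F0 [k k0 [Dx Dy]]] := FF.
have [smPhi _ PF] := bF.
have D0 : disk (0 : plane R) by rewrite diskE /= expr0n /= addr0.
have dF : differentiable F (0 : plane R) by exact: (Fharm.1.1 _ D0).1.
have -> : l = k by exact: (dnorm0E dotE d11 d22 d12 (ltW k0)).
have := boundary_moment dotE smPhi PF h 0 dF.
have := boundary_moment dotE smPhi PF h (pi / 2) dF.
rewrite cos_pihalf sin_pihalf -[(0, 1)]/(@dy R) Dy.
rewrite cos0 sin0 -[(1, 0)]/(@dx R) Dx !dotZl.
have -> : (fun t => cos (pi / 2 - t) * phi h t) = (fun t => sin t * phi h t).
  by apply/funext => t; rewrite -cosN opprB cosBpihalf.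
have -> : (fun t => cos (0 - t) * phi h t) = (fun t => cos t * phi h t).
  by apply/funext => t; rewrite sub0r cosN.
move=> [i2 v2] [i1 v1]; split.
- by rewrite -F0; exact: (boundary_mean dotE PF h).
- by split => //; rewrite mulrAC -v1 mulrAC divff // mul1r.
- by split => //; rewrite mulrAC -v2 mulrAC divff // mul1r.
Qed.

(** By [defect_sum], the sum of the two integrands of the identity. *)
Let defect_density (t : R) := 2 * weight s (expi t) -
  2 * (weight s (expi t) * dot (Phi (expi t)) (T (expi t))).

(** Expanding weight * <Phi, T> with [moebius_expi] leaves five moments of
    Phi, all known. *)
Lemma defect_integral :
  arc_has_integral defect_density (2 * c * (c * (1 - s ^+ 2) - l)).
Proof.
have [q0 q1 _] := boundary_moments q.
have [a0 a1 _] := boundary_moments e1.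
have [_ _ b2] := boundary_moments e2.
have h1 := arc_has_integralD (arc_has_integral_cst (2 * (1 + s ^+ 2)))
  (arc_has_integralZ (4 * s) (@arc_has_integral_cos R)).
have h2 := arc_has_integralD (arc_has_integralZ (- 2 * (1 + s ^+ 2)) q0)
  (arc_has_integralZ (- 4 * s) q1).
have h3 := arc_has_integralD (arc_has_integralZ (- 4 * s * c) a0)
  (arc_has_integralZ (- 2 * c * (1 + s ^+ 2)) a1).
have h4 := arc_has_integralZ (- 2 * c * (1 - s ^+ 2)) b2.
have := arc_has_integralD (arc_has_integralD h1 h2) (arc_has_integralD h3 h4).
congr arc_has_integral.
  apply/funext => t; have [W1 W2] := moebius_expi t.
  have -> : defect_density t = 2 * weight s (expi t)
      - 2 * (weight s (expi t) * phi q t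
      + c * phi e1 t * (weight s (expi t) * complex.Re (moebius s (expi t)))
      + c * phi e2 t * (weight s (expi t) * complex.Im (moebius s (expi t)))).
    rewrite /defect_density /moebius_disk 2!dotDr 2!dotZr.
    by move: (complex.Re _) (complex.Im _) => x y; ring.
  by rewrite W1 W2 weightE; ring.
rewrite !dotDl !dotZl dq1 d11 d22 (dotC dot e1 q) dq1 dotE.
have -> : `|q| ^+ 2 = 1 - c ^+ 2 by rewrite -qc; ring.
by field.
Qed.

Local Notation I1 := (\int[m]_t
  (weight s (expi t) * `|Phi (expi t) - T (expi t)| ^+ 2)%:E)%E.
Local Notation I2 := (\int[m]_t
  (weight s (expi t) * (1 - `|Phi (expi t)| ^+ 2))%:E)%E.

Lemma continuous_weight : continuous (fun t => weight s (expi t)).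
Proof.
rewrite (_ : (fun t => _) = fun t => 1 + s ^+ 2 + 2 * s * cos t); last first.
  by apply/funext => t; exact: weightE.
move=> t; apply: cvgD; first exact: cvg_cst.
by apply: cvgMr; exact: continuous_cos.
Qed.

Lemma defect_sum t : weight s (expi t) * `|Phi (expi t) - T (expi t)| ^+ 2 +
  weight s (expi t) * (1 - `|Phi (expi t)| ^+ 2) = defect_density t.
Proof.
rewrite /defect_density -!dotE dotBl !dotBr (dotC dot (T _)) (dotE (T _)).
by rewrite norm_moebius_expi expr1n; ring.
Qed.

Lemma measurable_weight :
  measurable_fun setT (fun t : measurableTypeR R => weight s (expi t)).
Proof. exact: continuous_measurable continuous_weight. Qed.

Lemma measurable_defect : measurable_fun setT
  (fun t : measurableTypeR R => weight s (expi t) * (1 - `|Phi (expi t)| ^+ 2)).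
Proof.
have [smPhi _ _] := bF.
apply: measurable_funM; first exact: measurable_weight.
apply: measurable_funB => //.
by apply: measurable_funX; exact: strongly_measurable_norm.
Qed.

Lemma measurable_dist : measurable_fun setT
  (fun t : measurableTypeR R => `|Phi (expi t) - T (expi t)| ^+ 2).
Proof.
(* The defect density is measurable as an integrable function; the distance
   is recovered from it by division by the positive weight. *)
rewrite (_ : (fun t => _) = fun t => (weight s (expi t))^-1 *
    (defect_density t - weight s (expi t) * (1 - `|Phi (expi t)| ^+ 2))).
  apply: measurable_funM.
    apply: continuous_measurable => t.
    apply: cvgV; first by rewrite gt_eqF ?weight_gt0.
    exact: continuous_weight.
  apply: measurable_funB; last exact: measurable_defect.
  by apply/measurable_EFinP; exact: measurable_int defect_integral.1.
apply/funext => t; rewrite -defect_sum addrK mulKf // gt_eqF //.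
exact: weight_gt0.
Qed.

(** The integrand of the second integral is nonnegative only almost
    everywhere; its positive part has the same integral and allows adding
    nonnegative functions before any integrability is known. *)
Lemma defect_identity :
  [/\ (2 * c * (c * (1 - s ^+ 2) - l))%:E = (I1 + I2)%E, (0 <= I1)%E & (0 <= I2)%E].
Proof.
have [smPhi _ PF] := bF; have [_ F1 _ _] := FF.
have [iJ vJ] := defect_integral.
pose f1 t := weight s (expi t) * `|Phi (expi t) - T (expi t)| ^+ 2.
pose f2 t := weight s (expi t) * (1 - `|Phi (expi t)| ^+ 2).
pose f3 t := Num.max (f2 t) 0.
have fJ t : f1 t + f2 t = defect_density t := defect_sum t.
have mf2 : measurable_fun setT (f2 : measurableTypeR R -> R) := measurable_defect.
have mJ : measurable_fun setT (defect_density : measurableTypeR R -> R).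
  by apply/measurable_EFinP; exact: measurable_int iJ.
have mf1 : measurable_fun setT (f1 : measurableTypeR R -> R).
  by apply: measurable_funM; [exact: measurable_weight|exact: measurable_dist].
have mf3 : measurable_fun setT (f3 : measurableTypeR R -> R).
  exact: (measurable_maxr mf2 (measurable_cst (0 : R))).
have f1_ge0 t : (0 <= (f1 t)%:E)%E.
  by rewrite lee_fin mulr_ge0 // ltW // weight_gt0.
have f3_ge0 t : (0 <= (f3 t)%:E)%E.
  by rewrite lee_fin le_max lexx orbT.
have f23 : {ae m, forall t, f3 t = f2 t}.
  have := boundary_norm_le1 dotE smPhi PF F1.
  apply: filter_app; first exact: (ae_filter_ringOfSetsType m).
  apply: aeW => t /= Phi1; rewrite /f3 max_l //.
  by rewrite mulr_ge0 ?(ltW (weight_gt0 t)) // subr_ge0 expr_le1.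
have I2E : (I2 = \int[m]_t (f3 t)%:E)%E.
  apply: ae_eq_integral => //; [exact/measurable_EFinP|exact/measurable_EFinP|].
  move: f23; apply: filter_app; first exact: (ae_filter_ringOfSetsType m).
  by apply: aeW => t /= -> _.
split; [|by apply: integral_ge0 => t _; exact: f1_ge0
  |by rewrite I2E; apply: integral_ge0 => t _; exact: f3_ge0].
have S : (\int[m]_t (f1 t)%:E + \int[m]_t (f3 t)%:E =
    \int[m]_t ((f1 t)%:E + (f3 t)%:E))%E.
  by rewrite ge0_integralD //; exact/measurable_EFinP.
rewrite I2E [RHS]S.
rewrite -vJ fineK; last by apply: integrable_fin_num.
apply: ae_eq_integral => //.
- exact/measurable_EFinP.
- by apply: emeasurable_funD; exact/measurable_EFinP.
- move: f23; apply: filter_app; first exact: (ae_filter_ringOfSetsType m).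
  by apply: aeW => t /= f3E _; rewrite -EFinD f3E fJ.
Qed.

(** The weight is at least (1 - s)^2 on the circle. *)
Lemma L2dist_defect :
  (L2dist Phi T ^+ 2 <= (2 * c * (c * (1 - s ^+ 2) - l) / (1 - s) ^+ 2)%:E)%E.
Proof.
have [e i1 i2] := defect_identity.
have s1 : 0 < (1 - s) ^+ 2 by rewrite exprn_gt0 // subr_gt0; case/andP: s01.
rewrite L2dist_sqr EFinM muleC lee_pdivlMl // e.
apply: le_trans (leeDl _ i2).
rewrite -ge0_integralZl //; last 2 first.
- apply/measurable_EFinP; exact: measurable_dist.
- by rewrite lee_fin ltW.
apply: ge0_le_integral => //.
- by move=> t _; rewrite -EFinM lee_fin mulr_ge0 // ltW.
- apply: measurable_funeM; apply/measurable_EFinP; exact: measurable_dist.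
- apply/measurable_EFinP; apply: measurable_funM; first exact: measurable_weight.
  exact: measurable_dist.
- move=> t _; rewrite -EFinM lee_fin ler_wpM2r //; exact: weight_ge.
Qed.

End defect.

Theorem theorem6p3 (R : realType) (H : completeNormedModType R)
    (dot : {dot H for idfun}) (dotE : forall x : H, dot x x = `|x| ^+ 2)
    (p : H) (p_lt1 : `|p| < 1)
    (Lam : set H) (Lam_dim2 : two_dim_subspace Lam)
    (pL pP : H) (pE : p = pL + pP) (LampL : Lam pL)
    (pP_orth : forall x : H, Lam x -> dot pP x = 0)
    (e1 e2 : H) (e12 : orthonormal_basis2 dot Lam e1 e2)
    (pLE : pL = `|pL| *: e1) :
  let a : R := `|pL| in
  let b : R := `|pP| in
  let c : R := Num.sqrt (1 - b ^+ 2) in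
  let s : R := a / c in
  let T : plane R -> H := moebius_disk pP e1 e2 c s in
  let FF : set (plane R -> H) := normalized_maps p e1 e2 in
  (forall F Phi : plane R -> H, FF F -> is_boundary_function Phi F ->
     let delta : R := dnorm0 T - dnorm0 F in
     let I1 : \bar R :=
       (\int[@arc_measure R]_t
          (weight s (expi t) * `|Phi (expi t) - T (expi t)| ^+ 2)%:E)%E in
     let I2 : \bar R :=
       (\int[@arc_measure R]_t
          (weight s (expi t) * (1 - `|Phi (expi t)| ^+ 2))%:E)%E in
     [/\ 0 <= delta,
         (2 * c * delta)%:E = (I1 + I2)%E,
         (I1 <= (2 * c * delta)%:E)%E &
         (L2dist Phi T ^+ 2 <= (2 * c * delta / (1 - s) ^+ 2)%:E)%E])
  /\
  (forall F_ Phi_ : nat -> plane R -> H,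
     (forall j, FF (F_ j)) ->
     (forall j, is_boundary_function (Phi_ j) (F_ j)) ->
     (dnorm0 (F_ j))%:E @[j --> \oo]
       --> ereal_sup [set (dnorm0 F)%:E | F in FF] ->
     L2dist (Phi_ j) T @[j --> \oo] --> 0%E).
Proof.
move=> a b c s T FF.
have [d11 d22 d12 LE] := e12.
have Le1 : Lam e1 by rewrite LE; exists 1, 0; rewrite scale1r scale0r addr0.
have Le2 : Lam e2 by rewrite LE; exists 0, 1; rewrite scale1r scale0r add0r.
have dq1 := pP_orth _ Le1; have dq2 := pP_orth _ Le2.
have ab : a ^+ 2 + b ^+ 2 < 1.
  have : `|p| ^+ 2 < 1 by rewrite expr_lt1.
  rewrite -dotE pE dotDl !dotDr !dotE (pP_orth _ LampL) (dotC dot pL).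
  rewrite (pP_orth _ LampL).
  by rewrite addr0 add0r.
have a0 : 0 <= a by exact: normr_ge0.
have c2 : c ^+ 2 = 1 - b ^+ 2.
  by rewrite sqr_sqrtr // subr_ge0; have := sqr_ge0 a; lra.
have c0 : 0 < c by rewrite sqrtr_gt0 subr_gt0; have := sqr_ge0 a; lra.
have qc : `|pP| ^+ 2 + c ^+ 2 = 1 by rewrite c2 addrC subrK.
have cs : c * s = a by rewrite mulrC divfK // gt_eqF.
have s01 : 0 <= s < 1.
  rewrite divr_ge0 ?(ltW c0) //= ltr_pdivrMr // mul1r.
  by rewrite -(@ltr_pXn2r _ 2) ?nnegrE // ?(ltW c0) // c2; lra.
have pcs : p = pP + (c * s) *: e1 by rewrite cs pE addrC; congr (_ + _).
have [TFF nT] := moebius_disk_normalized dotE d11 d22 d12 dq1 dq2 c0 qc s01.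
have FFp F : FF F -> normalized_maps (pP + (c * s) *: e1) e1 e2 F by rewrite -pcs.
rewrite -/T in TFF nT.
have dge0 F Phi : FF F -> is_boundary_function Phi F -> 0 <= dnorm0 T - dnorm0 F.
  move=> /FFp hF bF.
  have [e i1 i2] := defect_identity dotE d11 d22 d12 dq1 dq2 qc s01 hF bF.
  have : (0 <= (2 * c * (dnorm0 T - dnorm0 F))%:E)%E by rewrite nT e adde_ge0.
  by rewrite lee_fin pmulr_rge0 // mulr_gt0.
split=> [F Phi hF bF delta I1 I2|F_ Phi_ hF bF cv].
  have d0 := dge0 _ _ hF bF.
  have [e i1 i2] := defect_identity dotE d11 d22 d12 dq1 dq2 qc s01 (FFp _ hF) bF.
  have h := L2dist_defect dotE d11 d22 d12 dq1 dq2 qc s01 (FFp _ hF) bF.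
  rewrite /delta nT; rewrite nT in d0; split => //.
  by rewrite e leeDl.
have dcv : dnorm0 (F_ j) @[j --> \oo] --> dnorm0 T.
  suff E : ereal_sup [set (dnorm0 F)%:E | F in FF] = (dnorm0 T)%:E.
    by move: cv; rewrite E => /fine_cvg.
  apply/eqP; rewrite eq_le; apply/andP; split; last first.
    by apply: ereal_sup_ubound; exists T => //; rewrite /FF pcs.
  rewrite -(cvg_lim _ cv) //; apply: lime_le.
    by apply/cvg_ex; eexists; exact: cv.
  by apply: nearW => j; rewrite lee_fin -subr_ge0; exact: dge0.
(* The L^2 distance is at most the square root of K times the defect. *)
pose K := 2 * c / (1 - s) ^+ 2.
have Kcv : (Num.sqrt (K * (dnorm0 T - dnorm0 (F_ j))))%:E @[j --> \oo] --> 0%E.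
  apply: cvg_EFin; first exact: nearW.
  rewrite -[X in _ --> X]sqrtr0 -[X in Num.sqrt X](mulr0 K).
  rewrite -[X in K * X](subrr (dnorm0 T)).
  apply: continuous_cvg; first exact: sqrt_continuous.
  by apply: cvgMr; apply: cvgB; [exact: cvg_cst|exact: dcv].
apply: squeeze_cvge Kcv; last exact: cvg_cst.
apply: nearW => j; rewrite Lnorm_ge0 /=.
have d0 := dge0 _ _ (hF j) (bF j).
have h := L2dist_defect dotE d11 d22 d12 dq1 dq2 qc s01 (FFp _ (hF j)) (bF j).
have Kd : 0 <= K * (dnorm0 T - dnorm0 (F_ j)).
  by rewrite mulr_ge0 // divr_ge0 ?sqr_ge0 // mulr_ge0 // ltW.
rewrite -lee_sqr ?lee_fin ?sqrtr_ge0 ?Lnorm_ge0 //.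
rewrite -EFin_expe sqr_sqrtr //; apply: le_trans h _.
by rewrite lee_fin nT /K [leRHS]mulrAC.
Qed.
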